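(* Let $k\ge1$ and let $\phi=(\phi_1,\dots,\phi_k):\mathbb{D}^k\to\overline{\mathbb{D}}^k$ be an analytic map such that $C_\phi f=f\circ\phi$ defines a bounded operator $C_\phi:A^+(\mathbb{T}^k)\to A^+(\mathbb{T}^k)$. Then $C_\phi$ is an automorphism of $A^+(\mathbb{T}^k)$ (a bijective algebra homomorphism onto $A^+(\mathbb{T}^k)$) if and only if $\phi(z)=(\epsilon_1z_{\sigma(1)},\dots,\epsilon_kz_{\sigma(k)})$ for some permutation $\sigma$ of $\{1,\dots,k\}$ and some complex numbers $\epsilon_1,\dots,\epsilon_k$ of modulus $1$.
   Context: $A^+(\mathbb{T}^k)$ is the algebra of functions $f:\overline{\mathbb{D}}^k\to\mathbb{C}$ of the form $f(z)=\sum_{n_1,\dots,n_k\ge0}a(n_1,\dots,n_k)z_1^{n_1}\cdots z_k^{n_k}$ with $\|f\|_{A^+(\mathbb{T}^k)}=\sum|a(n_1,\dots,n_k)|<\infty$, a commutative unital Banach algebra under pointwise multiplication. *)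

(* Defs.v *)
From HB Require Import structures.
From mathcomp Require Import all_boot all_order all_algebra.
From mathcomp Require Import perm.
From mathcomp Require Import all_classical all_reals.
From mathcomp.real_closed Require Import complex.
Set Implicit Arguments. Unset Strict Implicit. Unset Printing Implicit Defensive.
Import Order.TTheory GRing.Theory Num.Theory.
Local Open Scope ring_scope.
Local Open Scope complex_scope.

Section Aplus.
Variables (R : realType) (k : nat).
Local Notation C := R[i].

Definition cpoint := 'I_k -> C.
Definition mindex := 'I_k -> nat.

Definition cabs (z : C) : R := ComplexField.Normc.normc z.

Definition in_open_polydisc (z : cpoint) : Prop := forall i, cabs (z i) < 1.
Definition in_closed_polydisc (z : cpoint) : Prop := forall i, cabs (z i) <= 1.

Definition monomial (z : cpoint) (n : mindex) : C := \prod_(i < k) z i ^+ n i.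

Definition box_sum (V : nmodType) (N : nat) (F : mindex -> V) : V :=
  \sum_(m : {ffun 'I_k -> 'I_N}) F (fun i => nat_of_ord (m i)).

Definition abs_summable (F : mindex -> C) : Prop :=
  exists M : R, forall N, box_sum N (fun n => cabs (F n)) <= M.

Definition series_sum_to (F : mindex -> C) (w : C) : Prop :=
  forall e : R, 0 < e -> exists N0 : nat, forall N, (N0 <= N)%N ->
    cabs (box_sum N F - w) < e.

Definition Aplus_coeffs (f : cpoint -> C) (a : mindex -> C) : Prop :=
  abs_summable a /\
  forall z, in_closed_polydisc z -> series_sum_to (fun n => a n * monomial z n) (f z).

Definition in_Aplus (f : cpoint -> C) : Prop := exists a, Aplus_coeffs f a.

Definition Aplus_norm (a : mindex -> C) : R :=
  sup (range (fun N : nat => box_sum N (fun n => cabs (a n)))).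

Definition analytic_on_polydisc (h : cpoint -> C) : Prop :=
  forall w, in_open_polydisc w ->
  exists r : R, 0 < r /\ exists c : mindex -> C,
    forall z, in_open_polydisc z -> (forall i, cabs (z i - w i) < r) ->
      abs_summable (fun n => c n * monomial (fun i => z i - w i) n) /\
      series_sum_to (fun n => c n * monomial (fun i => z i - w i) n) (h z).

Definition Cphi_graph (phi : cpoint -> cpoint) (f g : cpoint -> C) : Prop :=
  in_Aplus f /\ in_Aplus g /\ forall z, in_open_polydisc z -> g z = f (phi z).

Definition Cphi_bounded (phi : cpoint -> cpoint) : Prop :=
  exists M : R, 0 <= M /\
  forall f a, Aplus_coeffs f a ->
    exists g b, Aplus_coeffs g b /\
      (forall z, in_open_polydisc z -> g z = f (phi z)) /\
      Aplus_norm b <= M * Aplus_norm a.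

(* C_phi is an automorphism: it is (automatically) a unital algebra
   homomorphism, and it is bijective from A^+ onto A^+.  Elements of A^+
   are functions on the closed polydisc, compared pointwise there. *)
Definition Cphi_automorphism (phi : cpoint -> cpoint) : Prop :=
  (forall f1 f2 g, Cphi_graph phi f1 g -> Cphi_graph phi f2 g ->
     forall z, in_closed_polydisc z -> f1 z = f2 z) /\
  (forall g, in_Aplus g -> exists f, Cphi_graph phi f g).

End Aplus.

(* Main.v *)
(* If f o phi runs over A+ bijectively, there are psi_i in A+ with
   psi_i o phi = z_i.  Each psi_i has modulus at most 1, since otherwise
   1 / (lam - z_i) would pull back to an inverse of lam - psi_i for some value
   lam of psi_i.  Put a = phi(0) and F_j = (phi_j - a_j) / (1 - conj(a_j) phi_j),
   the image under C_phi of an element of A+.  Schwarz's lemma for psi_i on the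
   analytic disc through a and phi(z) gives |z_i| <= max_j |F_j(z)|.  Letting
   z = t e_i tend to 0, some F_j has a coefficient of modulus at least 1 at z_i,
   and Parseval forces F_j = eps z_i.  So phi_j is a Moebius map of a single
   coordinate.

   If a_j <> 0, boundedness of C_phi bounds the l^1 coefficient norms of
   v^n, v(z) = (z + rho) / (1 + rho z), 0 < rho < 1, uniformly in n.  The
   coefficients c_m of v^n satisfy
     rho (m-1) c_(m-1) + rho (m+1) c_(m+1) = (n (1 - rho^2) - (1 + rho^2) m) c_m.
   By Parseval some |c_m0| is bounded below, and then m0 is at least of order n,
   so near m0 this is almost c_(m+1) + c_(m-1) = 2 x c_m with x constant, and
   c_(m0+j) + c_(m0-j) is close to 2 T_j(x) c_m0.  Since T_2j = 2 T_j^2 - 1,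
   T_j and T_2j are never both small, and the l^1 norm of c is as large as we
   please. *)
Require Import Defs.
From HB Require Import structures.
From mathcomp Require Import all_boot all_order all_algebra.
From mathcomp Require Import perm cyclic separable cyclotomic.
From mathcomp Require Import all_classical all_reals.
From mathcomp.real_closed Require Import complex.
From mathcomp Require Import ring lra zify.
Set Implicit Arguments. Unset Strict Implicit. Unset Printing Implicit Defensive.
Import Order.TTheory GRing.Theory Num.Theory.
Local Open Scope ring_scope.
Local Open Scope complex_scope.

(** * Parseval, the maximum principle and the Schwarz lemma for polynomials *)

Section Modulus.
Variable R : realType.
Implicit Types (x y z : R[i]).

Lemma cabs_normE z : `|z| = (cabs z)%:C.
Proof. by []. Qed.

Lemma cabs_ge0 z : 0 <= cabs z.
Proof. by rewrite -lecR -cabs_normE normr_ge0. Qed.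

Lemma cabsM x y : cabs (x * y) = cabs x * cabs y.
Proof. exact: ComplexField.Normc.normcM. Qed.

Lemma cabsD x y : cabs (x + y) <= cabs x + cabs y.
Proof. exact: le_normcD. Qed.

Lemma cabsN x : cabs (- x) = cabs x.
Proof. exact: normcN. Qed.

Lemma cabsB x y : cabs (x - y) <= cabs x + cabs y.
Proof. by rewrite -(cabsN y) cabsD. Qed.

Lemma cabs_sym x y : cabs (x - y) = cabs (y - x).
Proof. by rewrite -cabsN opprB. Qed.

Lemma cabs_tri y x z : cabs (x - z) <= cabs (x - y) + cabs (y - z).
Proof. by rewrite -[x - z](subrKA y) cabsD. Qed.

Lemma cabs_rtri x y : cabs x - cabs y <= cabs (x - y).
Proof. by rewrite lerBlDr -{1}(subrK y x) cabsD. Qed.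

Lemma cabs_eq0 x : (cabs x == 0) = (x == 0).
Proof. by rewrite -(inj_eq (@complexI R)) -cabs_normE normr_eq0. Qed.

Lemma cabs_gt0 x : (0 < cabs x) = (x != 0).
Proof. by rewrite lt_neqAle cabs_ge0 andbT eq_sym cabs_eq0. Qed.

Lemma cabs0 : cabs (0 : R[i]) = 0.
Proof. by apply/eqP; rewrite cabs_eq0. Qed.

Lemma cabs_real (r : R) : cabs (r%:C) = `|r|.
Proof. by rewrite /cabs /= expr0n addr0 sqrtr_sqr. Qed.

Lemma cabs1 : cabs (1 : R[i]) = 1.
Proof. by rewrite (cabs_real 1) normr1. Qed.

Lemma cabsV x : cabs (x^-1) = (cabs x)^-1.
Proof. exact: ComplexField.Normc.normcV. Qed.

Lemma cabs_div x y : cabs (x / y) = cabs x / cabs y.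
Proof. by rewrite cabsM cabsV. Qed.

Lemma cabsX x n : cabs (x ^+ n) = cabs x ^+ n.
Proof. by elim: n => [|n IH]; rewrite ?expr0 ?cabs1 // !exprS cabsM IH. Qed.

Definition cconj z : R[i] := conjc z.

Lemma cconjM x y : cconj (x * y) = cconj x * cconj y.
Proof. exact: rmorphM. Qed.

Lemma cconjX z n : cconj (z ^+ n) = cconj z ^+ n.
Proof. exact: rmorphXn. Qed.

Lemma cconj_sum (I : Type) (r : seq I) (P : pred I) (F : I -> R[i]) :
  cconj (\sum_(i <- r | P i) F i) = \sum_(i <- r | P i) cconj (F i).
Proof. exact: rmorph_sum. Qed.

Lemma cabsJ x : cabs (cconj x) = cabs x.
Proof. by case: x => a b; rewrite /cabs /= sqrrN. Qed.

Lemma cabs_nat (n : nat) : cabs (n%:R : R[i]) = n%:R.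
Proof. by rewrite -[n%:R](rmorph_nat (real_complex R)) cabs_real normr_nat. Qed.

Lemma sqr_cabs z : (cabs z ^+ 2)%:C = z * cconj z.
Proof. by rewrite rmorphXn /= -sqr_normc. Qed.

Lemma cabs_sum (I : Type) (r : seq I) (P : pred I) (F : I -> R[i]) :
  cabs (\sum_(i <- r | P i) F i) <= \sum_(i <- r | P i) cabs (F i).
Proof.
elim/big_rec2: _ => [|i a b _ h]; first by rewrite cabs0.
by apply: le_trans (cabsD _ _) _; rewrite lerD2l.
Qed.

Lemma cabs_prod (I : Type) (r : seq I) (P : pred I) (F : I -> R[i]) :
  cabs (\prod_(i <- r | P i) F i) = \prod_(i <- r | P i) cabs (F i).
Proof. by elim/big_rec2: _ => [|i a b _ <-]; rewrite ?cabs1 ?cabsM. Qed.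

Lemma cabs_le0_eq0 x : cabs x <= 0 -> x = 0.
Proof. by move=> h; apply/eqP; rewrite -cabs_eq0 eq_le h cabs_ge0. Qed.

Lemma unimodular_mulJ z : cabs z = 1 -> z * cconj z = 1.
Proof. by move=> h; rewrite -sqr_cabs h expr1n. Qed.

Lemma unimodular_neq0 z : cabs z = 1 -> z != 0.
Proof. by rewrite -cabs_gt0 => ->. Qed.

End Modulus.

Section OneVariable.
Variable R : realType.
Local Notation C := R[i].
Implicit Types (p q : {poly C}) (z w : C).

(** ['X^N - 1] splits, and its roots are distinct because it is separable in characteristic zero;
    [N] distinct [N]-th roots of unity always include a primitive one. *)
Lemma unit_root_exists (N : nat) : (0 < N)%N ->
  exists w : C, N.-primitive_root w.
Proof.
move=> N_gt0.
pose p : {poly C} := 'X^N - 1; have [rs Dp] := closed_field_poly_normal p.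
rewrite (monicP _) ?monicXnsubC // scale1r in Dp.
have rn1 : all N.-unity_root rs by apply/allP=> z; rewrite -root_prod_XsubC -Dp.
have sz_rs : (N < (size rs).+1)%N.
  by rewrite -(size_prod_XsubC rs id) -Dp size_XnsubC.
have [|z] := hasP (has_prim_root N_gt0 rn1 _ sz_rs); last by exists z.
by rewrite -separable_prod_XsubC -Dp separable_Xn_sub_1 // pnatr_eq0 -lt0n.
Qed.

Lemma cabs_unity_root (N : nat) z : (0 < N)%N -> z ^+ N = 1 -> cabs z = 1.
Proof.
move=> N_gt0 h; apply/eqP.
by rewrite -(@pexpr_eq1 _ _ N) ?cabs_ge0 // -cabsX h cabs1.
Qed.

Lemma cabs_prim_root (N : nat) w : N.-primitive_root w -> cabs w = 1.
Proof.
move=> h; apply: (cabs_unity_root (prim_order_gt0 h)); exact: prim_expr_order.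
Qed.

(** The squared moduli expand into a double sum over [m] and [m'], and orthogonality kills its
    off-diagonal part. The abstract form serves both roots of unity in one variable and grids of
    them in several. *)
Lemma parseval_orthogonal (T I : finType) (chi : T -> I -> C) (c : I -> C) :
  (forall m m', \sum_t chi t m * cconj (chi t m') = (m == m')%:R * #|T|%:R) ->
  \sum_t cabs (\sum_m c m * chi t m) ^+ 2 = #|T|%:R * \sum_m cabs (c m) ^+ 2.
Proof.
move=> orth; apply: (@complexI R); rewrite rmorphM !rmorph_sum /= rmorph_nat.
transitivity (\sum_t \sum_m \sum_m' c m * chi t m * cconj (c m' * chi t m')).
  apply: eq_bigr => t _; rewrite sqr_cabs cconj_sum mulr_suml.
  by apply: eq_bigr => m _; rewrite mulr_sumr.
rewrite exchange_big /= mulr_sumr; apply: eq_bigr => m _.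
rewrite exchange_big /= (bigD1 m) //= [X in _ + X]big1 ?addr0.
  under eq_bigr => t _ do rewrite cconjM mulrACA.
  by rewrite -mulr_sumr orth eqxx mul1r -sqr_cabs mulrC.
move=> m' ne; under eq_bigr => t _ do rewrite cconjM mulrACA.
by rewrite -mulr_sumr orth eq_sym (negbTE ne) mul0r mulr0.
Qed.

(** This is a geometric sum of ratio [w ^+ m / w ^+ m'], whose [N]-th power is 1; for [m != m'] the
    ratio is not 1, both exponents being below [N]. *)
Lemma unit_root_orthogonal (N : nat) w (m m' : 'I_N) : N.-primitive_root w ->
  \sum_(t < N) w ^+ (t * m) * cconj (w ^+ (t * m')) = (m == m')%:R * N%:R.
Proof.
move=> pw; have w0 : w != 0 by apply/unimodular_neq0/(cabs_prim_root pw).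
have cw : cconj w = w^-1.
  by apply: (mulfI w0); rewrite unimodular_mulJ ?mulfV // (cabs_prim_root pw).
have -> : \sum_(t < N) w ^+ (t * m) * cconj (w ^+ (t * m')) =
          \sum_(t < N) (w ^+ m / w ^+ m') ^+ t.
  apply: eq_bigr => t _.
  by rewrite cconjX cw exprMn !exprVn -!exprM ![(t * _)%N]mulnC.
case: eqVneq => [->|ne].
  under eq_bigr => t _ do rewrite divff ?expf_neq0 // expr1n.
  by rewrite sumr_const card_ord mul1r.
rewrite mul0r; apply: (@mulfI _ (w ^+ m / w ^+ m' - 1)).
  rewrite subr_eq0; apply: contra ne => /eqP h.
  have : w ^+ m == w ^+ m' by rewrite -[X in _ == X]mul1r -h divfK ?expf_neq0.
  by rewrite (eq_prim_root_expr pw) !modn_small.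
rewrite mulr0 -subrX1 exprMn exprVn -!exprM ![(_ * N)%N]mulnC !exprM.
by rewrite (prim_expr_order pw) !expr1n divr1 subrr.
Qed.

Lemma parseval_poly (N : nat) w p : N.-primitive_root w -> (size p <= N)%N ->
  \sum_(t < N) cabs p.[w ^+ t] ^+ 2 = N%:R * \sum_(m < N) cabs p`_m ^+ 2.
Proof.
move=> pw sp.
have /(parseval_orthogonal (fun m : 'I_N => p`_m)) : forall m m' : 'I_N,
    \sum_(t < N) w ^+ (t * m) * cconj (w ^+ (t * m')) = (m == m')%:R * #|'I_N|%:R.
  by move=> m m'; rewrite card_ord unit_root_orthogonal.
rewrite card_ord => <-; apply: eq_bigr => t _.
rewrite (horner_coef_wide _ sp); congr (cabs _ ^+ 2).
by apply: eq_bigr => m _; rewrite exprM.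
Qed.

(** A discrete Cauchy estimate: by Parseval over the roots of unity of order [size p], the square of
    one coefficient is at most the mean of the squared moduli. *)
Lemma coef_le_circle p (B : R) :
  (forall z, cabs z = 1 -> cabs p.[z] <= B) -> forall m, cabs p`_m <= B.
Proof.
move=> hp m.
have B0 : 0 <= B by apply: le_trans (hp 1 _); rewrite ?cabs_ge0 ?cabs1.
have [ms|ms] := leqP (size p) m; first by rewrite nth_default // cabs0.
have N0 : (0 < size p)%N by apply: leq_ltn_trans ms.
have [w pw] := unit_root_exists N0.
rewrite -(ler_pXn2r (_ : 0 < 2)%N) ?nnegrE ?cabs_ge0 //.
rewrite -(@ler_pM2l _ (size p)%:R) ?ltr0n //.
apply: (@le_trans _ _ (\sum_(t < size p) cabs p.[w ^+ t] ^+ 2)).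
  rewrite (parseval_poly pw) // ler_pM2l ?ltr0n //.
  rewrite (bigD1 (Ordinal ms)) //= lerDl sumr_ge0 // => i _.
  by rewrite exprn_ge0 ?cabs_ge0.
apply: le_trans (_ : \sum_(t < size p) B ^+ 2 <= _); last first.
  by rewrite sumr_const card_ord mulr_natl.
apply: ler_sum => t _; rewrite lerXn2r ?nnegrE ?cabs_ge0 //.
by apply: hp; rewrite cabsX (cabs_prim_root pw) expr1n.
Qed.

(** Bernoulli's inequality makes the powers of any [x > 1] unbounded. *)
Lemma pow_bounded_le1 (x K : R) : 0 <= x -> (forall n, x ^+ n <= K) -> x <= 1.
Proof.
move=> x0 hK; rewrite leNgt; apply/negP => x1.
have bern n : 1 + n%:R * (x - 1) <= x ^+ n.
  elim: n => [|n IH]; first by rewrite mul0r addr0 expr0.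
  rewrite exprS -natr1; apply: le_trans (ler_wpM2l x0 IH).
  have := mulr_ge0 (ler0n R n) (sqr_ge0 (x - 1)); lra.
pose n := Num.bound (K / (x - 1)).
have hn : K / (x - 1) < n%:R.
  by apply: archi_boundP; rewrite divr_ge0 ?subr_ge0 ?(ltW x1) // (le_trans _ (hK 0%N)).
rewrite ltr_pdivrMr ?subr_gt0 // in hn.
have := le_trans (bern n) (hK n); lra.
Qed.

Lemma geom_sum_le (r : R) N : 0 <= r -> r < 1 ->
  \sum_(m < N) r ^+ m <= (1 - r)^-1.
Proof.
move=> r0 r1; have h : 0 < 1 - r by rewrite subr_gt0.
rewrite -(@ler_pM2l _ (1 - r)) // mulfV ?gt_eqF //.
by rewrite -opprB mulNr -subrX1 opprB gerBl exprn_ge0.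
Qed.

(* Tensor-power trick: the coefficients of [p ^+ n] are at most [B ^+ n]. *)
Lemma poly_max_principle p (B : R) :
  (forall z, cabs z = 1 -> cabs p.[z] <= B) ->
  forall z, cabs z <= 1 -> cabs p.[z] <= B.
Proof.
move=> hp z; rewrite le_eqVlt => /orP[/eqP|z1]; first exact: hp.
have B0 : 0 <= B by apply: le_trans (hp 1 _); rewrite ?cabs_ge0 ?cabs1.
have key n : cabs p.[z] ^+ n <= B ^+ n * (1 - cabs z)^-1.
  have hc := @coef_le_circle (p ^+ n) (B ^+ n) _.
  rewrite -cabsX -horner_exp horner_coef.
  apply: le_trans (cabs_sum _ _ _) _.
  apply: le_trans (_ : \sum_(m < size (p ^+ n)) B ^+ n * cabs z ^+ m <= _).
    apply: ler_sum => m _; rewrite cabsM cabsX ler_wpM2r ?exprn_ge0 ?cabs_ge0 //.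
    apply: hc => y y1; rewrite horner_exp cabsX lerXn2r ?nnegrE ?cabs_ge0 //.
    exact: hp.
  by rewrite -mulr_sumr ler_wpM2l ?exprn_ge0 // geom_sum_le ?cabs_ge0.
have [B1|B1] := ltrP 0 B; last first.
  have /eqP Bz : B == 0 by rewrite eq_le B1.
  by have := key 1%N; rewrite Bz expr1 expr0n /= mul0r.
rewrite -[B]mul1r -ler_pdivrMr //.
apply: (@pow_bounded_le1 _ (1 - cabs z)^-1) => [|n].
  by rewrite divr_ge0 ?cabs_ge0.
by rewrite exprMn exprVn ler_pdivrMr ?exprn_gt0 // mulrC.
Qed.

(** After division by ['X] the quotient has the same modulus as [p] on the unit circle, so the
    maximum principle applies to it. *)
Lemma poly_schwarz p (B : R) : p.[0] = 0 ->
  (forall z, cabs z = 1 -> cabs p.[z] <= B) ->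
  forall z, cabs z <= 1 -> cabs p.[z] <= B * cabs z.
Proof.
move=> p0 hp z z1.
have /factor_theorem[q Dq] : root p 0 by rewrite /root p0.
rewrite subr0 in Dq; rewrite Dq hornerM hornerX cabsM ler_wpM2r ?cabs_ge0 //.
apply: poly_max_principle z1 => y y1.
by have := hp y y1; rewrite Dq hornerM hornerX cabsM y1 mulr1.
Qed.

Lemma poly_lipschitz0 p : exists2 K : R, 0 <= K &
  forall z w, cabs z <= 1 -> cabs w <= 1 ->
    cabs (p.[z] - p.[w]) <= K * cabs (z - w).
Proof.
elim/poly_ind: p => [|p c [K K0 hK]].
  by exists 0 => // z w _ _; rewrite !horner0 subr0 cabs0 mul0r.
pose A := \sum_(i < size p) cabs p`_i.
have hA z : cabs z <= 1 -> cabs p.[z] <= A.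
  move=> z1; rewrite horner_coef; apply: le_trans (cabs_sum _ _ _) _.
  apply: ler_sum => i _; rewrite cabsM cabsX ler_piMr ?cabs_ge0 //.
  by rewrite exprn_ile1 ?cabs_ge0.
exists (K + A); first by rewrite addr_ge0 ?sumr_ge0 // => i _; apply: cabs_ge0.
move=> z w z1 w1; rewrite !hornerMXaddC.
have -> : p.[z] * z + c - (p.[w] * w + c) =
          (p.[z] - p.[w]) * z + p.[w] * (z - w) by ring.
apply: le_trans (cabsD _ _) _; rewrite !cabsM mulrDl; apply: lerD.
  by apply: le_trans (hK z w z1 w1); rewrite ler_piMr ?cabs_ge0.
by rewrite ler_wpM2r ?cabs_ge0 // hA.
Qed.

(** The values at [z] and at [(1 - d) z] differ by at most [K * d]. This carries bounds obtained
    inside the disc over to the unit circle. *)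
Lemma poly_le_closure p (B : R) :
  (forall z, cabs z < 1 -> cabs p.[z] <= B) ->
  forall z, cabs z <= 1 -> cabs p.[z] <= B.
Proof.
move=> hp z z1; apply/ler_addgt0Pr => e e0.
have [K K0 hK] := poly_lipschitz0 p.
pose d : R := Num.min (e / (K + 1)) 2^-1.
have K1 : 0 < K + 1 by lra.
have d0 : 0 < d by rewrite lt_min divr_gt0 //=; lra.
have d1 : d < 1 by rewrite gt_min orbC; apply/orP; left; lra.
have de : K * d <= e.
  have : d <= e / (K + 1) by rewrite ge_min lexx.
  rewrite ler_pdivlMr // => h; nra.
pose y := (1 - d)%:C * z.
have cy : cabs y = (1 - d) * cabs z.
  by rewrite cabsM cabs_real ger0_norm //; lra.
have y1 : cabs y < 1 by rewrite cy; have := cabs_ge0 z; nra.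
have := cabs_rtri p.[z] p.[y]; have := hp y y1.
have := hK z y z1 (ltW y1).
have -> : z - y = d%:C * z by rewrite /y rmorphB /=; ring.
rewrite cabsM cabs_real ger0_norm ?(ltW d0) // => h1 h2 h3.
have : K * (d * cabs z) <= e.
  apply: le_trans de; rewrite ler_wpM2l // ler_piMr // ltW //.
lra.
Qed.

End OneVariable.

(** * Chebyshev recurrences *)

Section Chebyshev.
Variables (R : realFieldType) (x : R).

(** The components are the Chebyshev polynomials T_n and T_(n+1) at [x]; carrying both makes the
    two-step recursion structural. The argument [x] is not confined to [-1, 1]. *)
Fixpoint cheb_pair n : R * R :=
  if n is m.+1 then let: (a, b) := cheb_pair m in (b, 2 * x * b - a) else (1, x).

Definition cheb n : R := (cheb_pair n).1.

Lemma cheb0 : cheb 0 = 1. Proof. by []. Qed.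

Lemma cheb1 : cheb 1 = x. Proof. by []. Qed.

Lemma chebSS n : cheb n.+2 = 2 * x * cheb n.+1 - cheb n.
Proof. by rewrite /cheb /=; case: (cheb_pair n). Qed.

(** The identity cos(a + b) + cos(a - b) = 2 cos a cos b in algebraic form, hence valid for every
    [x]. The induction carries two consecutive values of [i], as the recurrence demands. *)
Lemma cheb_mul i j : (i <= j)%N ->
  cheb (j + i) + cheb (j - i) = 2 * cheb i * cheb j.
Proof.
suff H : (forall j, (i <= j)%N ->
            cheb (j + i) + cheb (j - i) = 2 * cheb i * cheb j) /\
         (forall j, (i.+1 <= j)%N ->
            cheb (j + i.+1) + cheb (j - i.+1) = 2 * cheb i.+1 * cheb j).
  by move=> ij; apply: H.1.
elim: i => [|i [IH0 IH1]].
  split=> [l _|[//|l] _]; first by rewrite addn0 subn0 cheb0; ring.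
  by rewrite addn1 subn1 /= chebSS cheb1; ring.
split=> // l il.
have e1 := IH0 l (ltnW (ltnW il)); have e2 := IH1 l (ltnW il).
have -> : (l + i.+2)%N = (l + i).+2 by lia.
have h := chebSS (l - i.+2); have h2 := chebSS (l + i).
rewrite (_ : (l - i.+2).+2 = (l - i)%N) in h; last by lia.
rewrite (_ : (l - i.+2).+1 = (l - i.+1)%N) in h; last by lia.
rewrite addnS in e2.
have -> : 2 * cheb i.+2 * cheb l =
          2 * x * (2 * cheb i.+1 * cheb l) - 2 * cheb i * cheb l.
  by rewrite (chebSS i); ring.
rewrite -e1 -e2 h h2; ring.
Qed.

Lemma cheb_double j : cheb j.*2 = 2 * cheb j ^+ 2 - 1.
Proof.
have := cheb_mul (leqnn j); rewrite addnn subnn cheb0 => h.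
by rewrite -(addrK 1 (cheb j.*2)) h; ring.
Qed.

(** With t = T_j, the value T_2j = 2 t^2 - 1 is below -1/2 as soon as |t| < 1/2. *)
Lemma cheb_double_lower j : 2^-1 <= `|cheb j| + `|cheb j.*2|.
Proof.
rewrite cheb_double; set t := cheb j.
have [h|h] := lerP 2^-1 `|t|; first by apply: le_trans h _; rewrite lerDl.
apply: le_trans (_ : `|2 * t ^+ 2 - 1| <= _); last by rewrite lerDr.
rewrite -normrN; apply: le_trans (ler_norm _).
have := real_normK (num_real t); have := normr_ge0 t; nra.
Qed.

End Chebyshev.

(** * Tails of bounded monotone sequences and sums over doubled indices *)

Section RealSequences.
Variable R : realType.

Lemma nondecreasing_bounded_tail (u : nat -> R) (M : R) :
  (forall m n, (m <= n)%N -> u m <= u n) -> (forall n, u n <= M) ->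
  forall e, 0 < e -> exists K, forall N, (K <= N)%N -> u N - u K <= e.
Proof.
move=> mono ub e e0.
have hs : has_sup (range u).
  by split; [exists (u 0%N), 0%N | exists M => _ [n _ <-]].
have [_ [K _ <-] hK] := sup_adherent e0 hs.
exists K => N KN; have : u N <= sup (range u).
  by apply: ub_le_sup; [exists M => _ [n _ <-] | exists N].
move: hK; lra.
Qed.

(** Together with [sum_double_idx_le], this bounds the sum of [F j + F j.*2] over [j < J] by twice
    the sum of [F] below [J.*2]. *)
Lemma sum_double_le (F : nat -> R) J : (forall i, 0 <= F i) ->
  \sum_(j < J) F j.*2 <= \sum_(i < J.*2) F i.
Proof.
move=> F0; elim: J => [|J IH]; first by rewrite !big_ord0.
rewrite big_ord_recr doubleS !big_ord_recr /=.
by have := F0 J.*2.+1; lra.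
Qed.

Lemma sum_double_idx_le (F : nat -> R) J : (forall i, 0 <= F i) ->
  \sum_(j < J) F j <= \sum_(i < J.*2) F i.
Proof.
move=> F0; have h : (J <= J.*2)%N by rewrite -addnn leq_addr.
rewrite -!(big_mkord xpredT F) [X in _ <= X](big_cat_nat _ h) //=.
by rewrite lerDl sumr_ge0.
Qed.

End RealSequences.

(** * Truncated power series and order of vanishing at the origin *)

Section MobiusPowers.
Variable R : realType.
Local Notation C := R[i].

Definition poly_trunc (c : nat -> C) K : {poly C} := \poly_(m < K) c m.

Lemma horner_trunc (c : nat -> C) K z :
  (poly_trunc c K).[z] = \sum_(m < K) c m * z ^+ m.
Proof. by rewrite horner_poly. Qed.

Definition converges_to (u : nat -> C) (l : C) :=
  forall e : R, 0 < e -> exists N0, forall N, (N0 <= N)%N -> cabs (u N - l) < e.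

Lemma converges_to_le (u : nat -> C) l a (B : R) N1 :
  converges_to u l -> (forall N, (N1 <= N)%N -> cabs (u N - a) <= B) ->
  cabs (l - a) <= B.
Proof.
move=> ul hB; apply/ler_addgt0Pl => e e0.
have [N0 h] := ul e e0.
apply: le_trans (cabs_tri (u (maxn N0 N1)) _ _) _; rewrite (cabs_sym l); apply: lerD.
  by apply/ltW/h; rewrite leq_maxl.
by apply: hB; rewrite leq_maxr.
Qed.

(** Every term of the tail carries a factor [z ^+ K]. Keeping it in the bound is what later shows
    that the truncation error vanishes to order [K] at 0. *)
Lemma trunc_tail (c : nat -> C) z l K (tau : R) : cabs z <= 1 ->
  converges_to (fun N => \sum_(m < N) c m * z ^+ m) l ->
  (forall N, (K <= N)%N ->
     \sum_(m < N) cabs (c m) - \sum_(m < K) cabs (c m) <= tau) ->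
  cabs (l - (poly_trunc c K).[z]) <= tau * cabs z ^+ K.
Proof.
move=> z1 hl ht; apply: (converges_to_le (N1 := K)) hl _ => N KN.
rewrite horner_trunc -!(big_mkord xpredT (fun m => c m * z ^+ m)).
rewrite (big_cat_nat _ (n := K)) //= addrAC subrr add0r.
apply: le_trans (cabs_sum _ _ _) _.
apply: le_trans (_ : \sum_(K <= m < N) cabs (c m) * cabs z ^+ K <= _).
  rewrite big_nat_cond [X in _ <= X]big_nat_cond.
  apply: ler_sum => m /andP[/andP[Km _] _].
  rewrite cabsM cabsX ler_wpM2l ?cabs_ge0 //.
  by rewrite ler_wiXn2l ?cabs_ge0.
rewrite -mulr_suml ler_wpM2r ?exprn_ge0 ?cabs_ge0 //.
apply: le_trans (ht N KN); rewrite -!(big_mkord xpredT (fun m => cabs (c m))).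
by rewrite [X in _ <= X - _](big_cat_nat _ (n := K)) //= addrAC subrr add0r.
Qed.

(** Factors ['X] are split off one at a time: if [r = s * 'X^m] with [m < K], small real [t] give
    |s(t)| <= A t, hence s(0) = 0. *)
Lemma poly_vanishing_order (r : {poly C}) K (A : R) :
  (forall z, cabs z < 1 -> cabs r.[z] <= A * cabs z ^+ K) ->
  exists s, r = s * 'X^K.
Proof.
move=> hr.
suff H m : (m <= K)%N -> exists s, r = s * 'X^m by apply: H.
elim: m => [_|m IH mK]; first by exists r; rewrite expr0 mulr1.
have [s rs] := IH (ltnW mK).
have [L L0 hL] := poly_lipschitz0 s.
(* The hypothesis at the point 1/2 already forces the sign of [A]. *)
have A0 : 0 <= A.
  have h2 : cabs (2^-1 : C) < 1.
    by rewrite cabsV cabs_nat invf_lt1 // ltr1n.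
  have := le_trans (cabs_ge0 _) (hr _ h2).
  by rewrite pmulr_lge0 // exprn_gt0 // cabs_gt0 invr_eq0 pnatr_eq0.
have hs (t : R) : 0 < t -> t < 1 -> cabs s.[0] <= (A + L) * t.
  move=> t0 t1; have tt : cabs (t%:C) = t by rewrite cabs_real gtr0_norm.
  have := hr t%:C; rewrite rs hornerM hornerXn cabsM cabsX tt => /(_ t1).
  rewrite -(subnKC mK) addSnnS exprD mulrCA [X in X <= _]mulrC.
  rewrite ler_pM2l ?exprn_gt0 // exprS => h.
  have tK : t ^+ (K - m.+1) <= 1 by rewrite exprn_ile1 // ltW.
  have := hL 0 t%:C; rewrite cabs0 tt ler01 (ltW t1) => /(_ isT isT) h3.
  have := cabs_rtri s.[0] s.[t%:C]; rewrite sub0r cabsN tt in h3 => h4.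
  have : A * (t * t ^+ (K - m.+1)) <= A * t.
    by rewrite ler_wpM2l // ler_piMr // ltW.
  lra.
have s0 : s.[0] = 0.
  apply: cabs_le0_eq0; apply/ler_addgt0Pl => e e0; rewrite addr0.
  pose t := Num.min (e / (A + L + 1)) 2^-1.
  have A1 : 0 < A + L + 1 by lra.
  have t0 : 0 < t by rewrite lt_min divr_gt0 //=; lra.
  have t1 : t < 1 by rewrite gt_min orbC; apply/orP; left; lra.
  have te : t <= e / (A + L + 1) by rewrite ge_min lexx.
  rewrite ler_pdivlMr // in te.
  apply: le_trans (hs t t0 t1) _; lra.
have /factor_theorem[q Dq] : root s 0 by rewrite /root s0.
by exists q; rewrite rs Dq subr0 -mulrA -exprS.
Qed.

End MobiusPowers.

(** * Differential equation and coefficient recurrence for powers of a Moebius map *)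

Section MobiusRecurrence.
Variables (F : fieldType) (r : F) (n : nat).
Let P : {poly F} := r%:P * 'X + 1.
Let Q : {poly F} := 'X + r%:P.

(** For v = Q/P one has P Q (v^n)' = n (1 - r^2) v^n, since Q' P - Q P' = P - r Q = 1 - r^2. As [q]
    agrees with v^n to order [K.+1], it satisfies the equation modulo ['X^K], one order being lost
    to the derivative. *)
Lemma mobius_pow_ode (q s : {poly F}) K : q * P ^+ n - Q ^+ n = s * 'X^(K.+1) ->
  dvdp 'X^K (q^`() * (P * Q) - (n%:R * (1 - r ^+ 2))%:P * q).
Proof.
move=> Ds; set D := q^`() * _ - _.
have dP : P^`() = r%:P by rewrite /P derivD derivM !derivC derivX mul0r add0r mulr1 addr0.
have dQ : Q^`() = 1 by rewrite /Q derivD derivX derivC addr0.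
have hT : P * (P ^+ n)^`() = n%:R * r%:P * P ^+ n.
  rewrite deriv_exp dP; case: n => [|m]; first by rewrite !(mulr0n, mul0r, mulr0).
  by rewrite -mulr_natl exprS /=; ring.
have hS : Q * (Q ^+ n)^`() = n%:R * Q ^+ n.
  rewrite deriv_exp dQ; case: n => [|m]; first by rewrite !(mulr0n, mul0r, mulr0).
  by rewrite -mulr_natl exprS /=; ring.
(* [P] has constant term 1, so divisibility by ['X^K] may be tested after multiplying by [P ^+ n],
   which clears the denominator of v^n. *)
have cop : coprimep 'X^K (P ^+ n).
  rewrite coprimep_expl // coprimep_expr // coprimep_sym.
  by rewrite coprimepX /root /P !hornerE /= oner_eq0.
rewrite -(Gauss_dvdpr _ cop).
have -> : P ^+ n * D = P * Q * (q * P ^+ n - Q ^+ n)^`()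
                       - n%:R * P * (q * P ^+ n - Q ^+ n).
  rewrite /D; have -> : (n%:R * (1 - r ^+ 2))%:P = n%:R * (P - r%:P * Q) :> {poly F}.
    by rewrite polyCM polyCB polyC1 polyC_exp -polyC_natr /P /Q; ring.
  rewrite derivB derivM.
  have -> : P * Q * (q^`() * P ^+ n + q * (P ^+ n)^`() - (Q ^+ n)^`()) =
    P * Q * q^`() * P ^+ n + q * Q * (P * (P ^+ n)^`())
    - P * (Q * (Q ^+ n)^`()) by ring.
  by rewrite hT hS; ring.
rewrite Ds; apply: dvdp_sub; last by rewrite mulrA exprS mulrA dvdp_mulIr.
rewrite derivM derivXn /= -mulr_natr exprS.
have -> : P * Q * (s^`() * ('X * 'X^K) + s * ('X^K * K.+1%:R)) =
          P * Q * (s^`() * 'X + s * K.+1%:R) * 'X^K by ring.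
exact: dvdp_mulIr.
Qed.

(** These are the coefficients of ['X^m] in the differential equation, with P Q = r X^2 + (1 + r^2)
    X + r. At [m = 0] the term in [m.-1] vanishes through its factor [m.-1%:R]. *)
Lemma mobius_pow_recurrence (c : nat -> F) (s : {poly F}) K m :
  (\poly_(i < K.+1) c i) * P ^+ n - Q ^+ n = s * 'X^(K.+1) -> (m < K)%N ->
  r * m.-1%:R * c m.-1 + r * m.+1%:R * c m.+1 =
  (n%:R * (1 - r ^+ 2) - (1 + r ^+ 2) * m%:R) * c m.
Proof.
move=> Ds mK; have := mobius_pow_ode Ds; set q := \poly_(i < _) _.
case/dvdpP=> u Du.
have := congr1 (fun p : {poly F} => p`_m) Du.
rewrite coefMXn mK coefB coefCM.
have -> : q^`() * (P * Q) = (r%:P * (q^`() * 'X) + (1 + r ^+ 2)%:P * q^`()) * 'X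
                            + r%:P * q^`().
  by rewrite /P /Q polyCD polyC1 polyC_exp; ring.
rewrite coefD coefMX coefCM coefD !coefCM coefMX !coef_deriv !coef_poly.
rewrite !ltnS mK (ltnW mK).
case: m mK => [|[|m]] mK /=.
- move=> /eqP; rewrite -![c _ *+ _]mulr_natr subr_eq0 => /eqP h.
  rewrite mulrBl -h; ring.
- move=> /eqP; rewrite (ltnW mK) -![c _ *+ _]mulr_natr subr_eq0 => /eqP h.
  rewrite mulrBl -h; ring.
- move=> /eqP; rewrite !(ltnW (ltnW mK)) (ltnW mK) -![c _ *+ _]mulr_natr subr_eq0 => /eqP h.
  rewrite mulrBl -h; ring.
Qed.

End MobiusRecurrence.

(** * Stability of the Chebyshev recurrence *)

Section ChebyshevPerturbation.
Variables (R : realType).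

(* Bound for the propagation of a unit error through the three-term recurrence. *)
Fixpoint cheb_error_pair (Kb : R) n : R * R :=
  if n is m.+1 then let: (a, b) := cheb_error_pair Kb m in (b, Kb * b + a + 2) else (0, 1).

Definition cheb_error Kb n : R := (cheb_error_pair Kb n).1.

Lemma cheb_errorSS Kb n : cheb_error Kb n.+2 = Kb * cheb_error Kb n.+1 + cheb_error Kb n + 2.
Proof. by rewrite /cheb_error /=; case: (cheb_error_pair Kb n). Qed.

Lemma cheb_error_ge0 Kb n : 0 <= Kb -> 0 <= cheb_error Kb n.
Proof.
move=> K0; suff [] : 0 <= cheb_error Kb n /\ 0 <= cheb_error Kb n.+1 by [].
elim: n => [|n [h0 h1]]; first by rewrite /cheb_error /= ler01.
by split=> //; rewrite cheb_errorSS !addr_ge0 ?mulr_ge0.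
Qed.

(** The exact solution with these initial data is 2 T_j(x) c. The deviation at [j.+2] is at most
    [Kb] times that at [j.+1], plus that at [j], plus [2 * eta], which is the recursion of
    [cheb_error]. *)
Lemma cheb_perturbed (x Kb eta : R) (s : nat -> R[i]) (c : R[i]) N :
  `|2 * x| <= Kb -> 0 <= eta ->
  s 0 = 2 * c -> cabs (s 1 - 2 * x%:C * c) <= eta ->
  (forall j, (j < N)%N -> cabs (s j.+2 + s j - 2 * x%:C * s j.+1) <= 2 * eta) ->
  forall j, (j <= N)%N -> cabs (s j - 2 * (cheb x j)%:C * c) <= cheb_error Kb j * eta.
Proof.
move=> hx e0 s0 s1 hs.
have K0 : 0 <= Kb by apply: le_trans hx.
suff H j : (j <= N)%N ->
    cabs (s j - 2 * (cheb x j)%:C * c) <= cheb_error Kb j * eta /\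
    ((j < N)%N -> cabs (s j.+1 - 2 * (cheb x j.+1)%:C * c) <= cheb_error Kb j.+1 * eta).
  by move=> j /H[].
elim: j => [_|j IH jN].
  rewrite s0 cheb0 mulr1 subrr cabs0 /cheb_error /= mul0r lexx; split=> // _.
  by rewrite cheb1 mul1r.
have [h0 /(_ jN) h1] := IH (ltnW jN); split=> // jN'.
have h2 := hs j jN.
have -> : s j.+2 - 2 * (cheb x j.+2)%:C * c =
  (s j.+2 + s j - 2 * x%:C * s j.+1) +
  ((2 * x)%:C * (s j.+1 - 2 * (cheb x j.+1)%:C * c) -
   (s j - 2 * (cheb x j)%:C * c)).
  by rewrite chebSS rmorphB !rmorphM /= rmorph_nat; ring.
apply: le_trans (cabsD _ _) _; rewrite cheb_errorSS.
have h3 : cabs ((2 * x)%:C * (s j.+1 - 2 * (cheb x j.+1)%:C * c)) <=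
          Kb * cheb_error Kb j.+1 * eta.
  by rewrite cabsM cabs_real -[X in _ <= X]mulrA ler_pM ?cabs_ge0.
have := cabsB ((2 * x)%:C * (s j.+1 - 2 * (cheb x j.+1)%:C * c))
              (s j - 2 * (cheb x j)%:C * c).
lra.
Qed.

End ChebyshevPerturbation.

(** * Unboundedness of the powers of a Moebius map *)

Section MobiusPowersUnbounded.
Variable R : realType.
Local Notation C := R[i].
Variables (rho : R) (rho_gt0 : 0 < rho) (rho_lt1 : rho < 1).
Let rc : C := rho%:C.

Definition mobius_pow_coeffs (M : R) n (c : nat -> C) :=
  (forall N, \sum_(m < N) cabs (c m) <= M) /\
  (forall z : C, cabs z < 1 ->
     converges_to (fun N => \sum_(m < N) c m * z ^+ m)
                  (((z + rho%:C) / (1 + rho%:C * z)) ^+ n)).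

Let cabs_rc : cabs rc = rho.
Proof. by rewrite cabs_real gtr0_norm. Qed.

Lemma mobius_den_lower (z : C) : cabs z <= 1 -> 1 - rho <= cabs (rc * z + 1).
Proof.
move=> z1; have := cabs_rtri 1 (- (rc * z)); rewrite cabsN opprK cabs1 cabsM cabs_rc.
rewrite [rc * z + 1]addrC => h.
have : rho * cabs z <= rho by rewrite ler_piMr // ltW.
lra.
Qed.

Section FixedPower.
Variables (M : R) (n : nat) (c : nat -> C).
Hypothesis hc : mobius_pow_coeffs M n c.
Let P : {poly C} := rc%:P * 'X + 1.
Let Q : {poly C} := 'X + rc%:P.

Lemma mobius_coef_le m : cabs (c m) <= M.
Proof.
apply: le_trans (hc.1 m.+1); rewrite big_ord_recr /= lerDr.
by rewrite sumr_ge0 // => i _; apply: cabs_ge0.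
Qed.

(** Multiplication by the n-th power of the denominator turns the truncation error into a
    polynomial, at the price of [2 ^+ n]. *)
Lemma mobius_trunc_error K (tau : R) :
  (forall N, (K <= N)%N ->
     \sum_(m < N) cabs (c m) - \sum_(m < K) cabs (c m) <= tau) ->
  forall z, cabs z < 1 ->
  cabs (poly_trunc c K * P ^+ n - Q ^+ n).[z] <= tau * 2 ^+ n * cabs z ^+ K.
Proof.
move=> ht z z1; have h := trunc_tail (ltW z1) (hc.2 z z1) ht.
have d0 : rc * z + 1 != 0.
  by rewrite -cabs_gt0; apply: lt_le_trans (mobius_den_lower (ltW z1)); rewrite subr_gt0.
have -> : (poly_trunc c K * P ^+ n - Q ^+ n).[z] =
   - (((z + rc) / (1 + rc * z)) ^+ n - (poly_trunc c K).[z]) * (rc * z + 1) ^+ n.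
  rewrite !(hornerE, horner_exp) [1 + _]addrC opprB mulrBl expr_div_n divfK //.
  by rewrite expf_neq0.
rewrite cabsM cabsN cabsX mulrAC ler_pM ?exprn_ge0 ?cabs_ge0 //.
rewrite lerXn2r ?nnegrE ?cabs_ge0 //.
apply: le_trans (cabsD _ _) _; rewrite cabs1 cabsM cabs_rc.
have : rho * cabs z <= 1 * 1 by rewrite ler_pM ?cabs_ge0 // ltW.
lra.
Qed.

Lemma mobius_coef_recurrence m :
  rc * m.-1%:R * c m.-1 + rc * m.+1%:R * c m.+1 =
  (n%:R * (1 - rc ^+ 2) - (1 + rc ^+ 2) * m%:R) * c m.
Proof.
(* The crude tail bound [M] suffices, because only the order of vanishing [m.+2] of the truncation
   error matters. *)
have ht N : (m.+2 <= N)%N ->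
    \sum_(i < N) cabs (c i) - \sum_(i < m.+2) cabs (c i) <= M.
  move=> _; apply: le_trans (hc.1 N); rewrite gerBl sumr_ge0 // => i _.
  exact: cabs_ge0.
have [s Ds] := poly_vanishing_order (mobius_trunc_error ht).
exact: mobius_pow_recurrence Ds _.
Qed.

(** Multiplying [z + rc] by the conjugate of [z] gives 1 + rho conj(z), the conjugate of the
    right-hand side. *)
Lemma mobius_unimodular (z : C) : cabs z = 1 -> cabs (z + rc) = cabs (rc * z + 1).
Proof.
move=> z1; rewrite -[LHS]mul1r -{1}z1 -(cabsJ z) -cabsM mulrDr mulrC unimodular_mulJ //.
rewrite -[RHS]cabsJ; congr cabs.
have -> : cconj (rc * z + 1) = cconj (rc * z) + cconj 1 by exact: rmorphD.
rewrite cconjM addrC mulrC; congr (_ * _ + _).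
  by rewrite /cconj conjc_real.
by rewrite /cconj conjc1.
Qed.

(** On the unit circle v^n has modulus 1, so a good truncation has modulus at least 1/2 there, and
    Parseval gives a sum of squares of at least 1/4. If all coefficients were below 1/(8M), the l^1
    bound [M] would make that sum at most 1/8. *)
Lemma mobius_coef_large : 1 <= M -> exists m, (8 * M)^-1 <= cabs (c m).
Proof.
move=> M1; have r1 : 0 < 1 - rho by rewrite subr_gt0.
(* Chosen so that [tau * 2 ^+ n] is half of [(1 - rho) ^+ n], the lower bound for the n-th power of
   the denominator. *)
pose tau := 2^-1 * ((1 - rho) / 2) ^+ n.
have tau0 : 0 < tau by rewrite mulr_gt0 ?exprn_gt0 ?divr_gt0 ?invr_gt0.
have mono i j : (i <= j)%N -> \sum_(m < i) cabs (c m) <= \sum_(m < j) cabs (c m).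
  move=> ij; rewrite -!(big_mkord xpredT (fun m => cabs (c m))).
  rewrite [X in _ <= X](big_cat_nat _ ij) //= lerDl sumr_ge0 // => k _.
  exact: cabs_ge0.
have [K0 hK0] := nondecreasing_bounded_tail mono hc.1 tau0.
(* The successor makes [K] positive, so that a primitive [K]-th root of unity exists. *)
pose K := K0.+1.
have hK N : (K <= N)%N ->
    \sum_(m < N) cabs (c m) - \sum_(m < K) cabs (c m) <= tau.
  move=> KN; apply: le_trans (hK0 N (ltnW KN)); rewrite lerD2l lerN2.
  exact: mono.
pose q := poly_trunc c K.
(* Convergence is given only in the open disc; the error is a polynomial, so its bound extends to
   the circle where Parseval is applied. *)
have err z : cabs z <= 1 ->
    cabs (q * P ^+ n - Q ^+ n).[z] <= 2^-1 * (1 - rho) ^+ n.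
  apply: poly_le_closure => y y1.
  apply: le_trans (mobius_trunc_error hK y1) _.
  rewrite /tau expr_div_n mulrA divfK ?expf_neq0 ?pnatr_eq0 //.
  rewrite ler_piMr ?exprn_ile1 ?cabs_ge0 ?(ltW y1) //.
  by apply: mulr_ge0; rewrite ?exprn_ge0 ?invr_ge0 ?(ltW r1).
have low z : cabs z = 1 -> 2^-1 <= cabs q.[z].
  move=> z1; have z1' : cabs z <= 1 by rewrite z1.
  have h1 := err z z1'; have h2 := mobius_den_lower z1'.
  have h3 : (1 - rho) ^+ n <= cabs (rc * z + 1) ^+ n.
    by rewrite lerXn2r ?nnegrE ?cabs_ge0 // ltW.
  move: h1; rewrite !(hornerE, horner_exp) => h1.
  have := cabs_rtri ((z + rc) ^+ n) (q.[z] * (rc * z + 1) ^+ n).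
  rewrite cabs_sym !cabsM !cabsX mobius_unimodular // => h4.
  have h5 : 0 < cabs (rc * z + 1) ^+ n.
    by apply: lt_le_trans h3; rewrite exprn_gt0.
  rewrite -(ler_pM2r h5); lra.
have [w pw] := @unit_root_exists R K isT.
have sq : (size q <= K)%N by apply: size_poly.
have pars := parseval_poly pw sq.
have lowsum : K%:R * 4^-1 <= K%:R * \sum_(m < K) cabs q`_m ^+ 2.
  rewrite -pars; apply: le_trans (_ : \sum_(t < K) 4^-1 <= _).
    by rewrite sumr_const card_ord mulr_natl.
  apply: ler_sum => t _.
  have := low (w ^+ t); rewrite cabsX (cabs_prim_root pw) expr1n => /(_ erefl).
  nra.
rewrite ler_pM2l ?ltr0n // in lowsum.
apply: contrapT => hn.
have small m : cabs (c m) < (8 * M)^-1.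
  by rewrite ltNge; apply/negP => h; apply: hn; exists m.
have : \sum_(m < K) cabs q`_m ^+ 2 <= 8^-1.
  apply: le_trans (_ : \sum_(m < K) (8 * M)^-1 * cabs (c m) <= _).
    apply: ler_sum => m _; rewrite coef_poly ltn_ord expr2.
    by rewrite ler_wpM2r ?cabs_ge0 // ltW.
  rewrite -mulr_sumr; apply: le_trans (_ : (8 * M)^-1 * M <= _).
    by rewrite ler_wpM2l ?hc.1 // invr_ge0; lra.
  by rewrite invfM mulfVK //; lra.
lra.
Qed.

End FixedPower.

(** The coefficients of the recurrence at [m] are frozen at [m0]. With d = m - m0 the three errors
    have factors rho (d + 1), rho (d - 1) and (1 + rho^2) d, at most D + 1, D + 1 and 2 (D + 1) in
    modulus. *)
Lemma mobius_window_step M n c m0 m (D : R) :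
  mobius_pow_coeffs M n c -> (0 < m0)%N -> (0 < m)%N ->
  `|m%:R - m0%:R| <= D ->
  cabs (c m.+1 + c m.-1 -
    2 * ((n%:R * (1 - rho ^+ 2) - (1 + rho ^+ 2) * m0%:R) / (2 * rho * m0%:R))%:C * c m)
  <= 4 * (D + 1) * M / (rho * m0%:R).
Proof.
move=> hc m0_gt0 m_gt0 hD.
set kap := _ / _; have m0R : 0 < m0%:R :> R by rewrite ltr0n.
have M0 : 0 <= M by apply: le_trans (mobius_coef_le hc 0); apply: cabs_ge0.
rewrite ler_pdivlMr ?mulr_gt0 //.
rewrite -[X in _ * X]gtr0_norm ?mulr_gt0 // -cabs_real -cabsM.
have kapE : 2 * kap%:C * (rho * m0%:R)%:C = n%:R * (1 - rc ^+ 2) - (1 + rc ^+ 2) * m0%:R.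
  rewrite -[2](rmorph_nat (real_complex R)) -!rmorphM /=.
  have -> : 2 * kap * (rho * m0%:R) = n%:R * (1 - rho ^+ 2) - (1 + rho ^+ 2) * m0%:R.
    by rewrite /kap; field; rewrite !gt_eqF.
  by rewrite !(rmorphB, rmorphD, rmorphM, rmorphXn, rmorph1, rmorph_nat).
have rec := mobius_coef_recurrence hc m.
have mE : m.-1%:R = m%:R - 1 :> C by rewrite -subn1 natrB.
rewrite mE -natr1 in rec.
pose d : C := m%:R - m0%:R.
have cd : cabs d <= D.
  rewrite /d -[m%:R](rmorph_nat (real_complex R)) -[m0%:R](rmorph_nat (real_complex R)).
  by rewrite -rmorphB cabs_real.
have -> : (c m.+1 + c m.-1 - 2 * kap%:C * c m) * (rho * m0%:R)%:C =
   - (rc * (d + 1) * c m.+1 + rc * (d - 1) * c m.-1 + (1 + rc ^+ 2) * d * c m).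
  have -> : (c m.+1 + c m.-1 - 2 * kap%:C * c m) * (rho * m0%:R)%:C =
     (c m.+1 + c m.-1) * (rc * m0%:R) - (2 * kap%:C * (rho * m0%:R)%:C) * c m.
    by rewrite [(rho * _)%:C]rmorphM /= rmorph_nat /rc; ring.
  rewrite kapE.
  have -> : (n%:R * (1 - rc ^+ 2) - (1 + rc ^+ 2) * m0%:R) * c m =
    (n%:R * (1 - rc ^+ 2) - (1 + rc ^+ 2) * m%:R) * c m + (1 + rc ^+ 2) * d * c m.
    by rewrite /d; ring.
  by rewrite -rec /d; ring.
rewrite cabsN.
have D0 : 0 <= D by apply: le_trans cd; apply: cabs_ge0.
have c1 := mobius_coef_le hc m.+1; have c2 := mobius_coef_le hc m.-1.
have c3 := mobius_coef_le hc m.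
have b1 : cabs (rc * (d + 1) * c m.+1) <= 1 * (D + 1) * M.
  rewrite !cabsM cabs_rc !ler_pM ?mulr_ge0 ?cabs_ge0 ?(ltW rho_gt0) ?(ltW rho_lt1) //.
  by apply: le_trans (cabsD _ _) _; rewrite cabs1 lerD2r.
have b2 : cabs (rc * (d - 1) * c m.-1) <= 1 * (D + 1) * M.
  rewrite !cabsM cabs_rc !ler_pM ?mulr_ge0 ?cabs_ge0 ?(ltW rho_gt0) ?(ltW rho_lt1) //.
  by apply: le_trans (cabsB _ _) _; rewrite cabs1 lerD2r.
have b3 : cabs ((1 + rc ^+ 2) * d * c m) <= 2 * (D + 1) * M.
  rewrite !cabsM !ler_pM ?mulr_ge0 ?cabs_ge0 //; last by lra.
  apply: le_trans (cabsD _ _) _; rewrite cabs1 cabsX cabs_rc.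
  have : rho ^+ 2 <= 1 by rewrite exprn_ile1 // ltW.
  lra.
apply: le_trans (cabsD _ _) _; have := cabsD (rc * (d + 1) * c m.+1) (rc * (d - 1) * c m.-1).
lra.
Qed.

(** The recurrence at [m0] is solved for n (1 - rho^2) c_m0; bounding coefficients by [M] leaves the
    factors m0, m0 + 1 and 2 m0. So a coefficient that is not small sits at an index at least of
    order [n]. *)
Lemma mobius_large_index M n c m0 (delta : R) :
  mobius_pow_coeffs M n c -> delta <= cabs (c m0) ->
  n%:R * (1 - rho ^+ 2) * delta <= (4 * m0%:R + 1) * M.
Proof.
move=> hc hd; have rec := mobius_coef_recurrence hc m0.
have M0 : 0 <= M by apply: le_trans (mobius_coef_le hc 0); apply: cabs_ge0.
have r2 : rho ^+ 2 <= 1 by rewrite exprn_ile1 // ltW.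
have r20 : 0 <= rho ^+ 2 by rewrite sqr_ge0.
apply: le_trans (_ : n%:R * (1 - rho ^+ 2) * cabs (c m0) <= _).
  by rewrite ler_wpM2l // mulr_ge0 // subr_ge0.
have <- : cabs (n%:R * (1 - rc ^+ 2) * c m0) = n%:R * (1 - rho ^+ 2) * cabs (c m0).
  rewrite !cabsM cabs_nat; congr (_ * _ * _).
  have -> : 1 - rc ^+ 2 = (1 - rho ^+ 2)%:C by rewrite rmorphB rmorphXn rmorph1.
  by rewrite cabs_real ger0_norm // subr_ge0.
have -> : n%:R * (1 - rc ^+ 2) * c m0 = rc * m0.-1%:R * c m0.-1 +
   rc * m0.+1%:R * c m0.+1 + (1 + rc ^+ 2) * m0%:R * c m0.
  by rewrite rec; ring.
have pm : m0.-1%:R <= m0%:R :> R by rewrite ler_nat leq_pred.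
have b1 : cabs (rc * m0.-1%:R * c m0.-1) <= 1 * m0%:R * M.
  by rewrite !cabsM cabs_rc cabs_nat !ler_pM ?mulr_ge0 ?cabs_ge0 ?(mobius_coef_le hc) ?(ltW rho_gt0) ?(ltW rho_lt1).
have b2 : cabs (rc * m0.+1%:R * c m0.+1) <= 1 * m0.+1%:R * M.
  by rewrite !cabsM cabs_rc cabs_nat !ler_pM ?mulr_ge0 ?cabs_ge0 ?(mobius_coef_le hc) ?(ltW rho_gt0) ?(ltW rho_lt1).
have b3 : cabs ((1 + rc ^+ 2) * m0%:R * c m0) <= 2 * m0%:R * M.
  rewrite !cabsM cabs_nat !ler_pM ?mulr_ge0 ?cabs_ge0 ?(mobius_coef_le hc) //.
  by apply: le_trans (cabsD _ _) _; rewrite cabs1 cabsX cabs_rc; lra.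
apply: le_trans (cabsD _ _) _.
have := cabsD (rc * m0.-1%:R * c m0.-1) (rc * m0.+1%:R * c m0.+1).
rewrite -natr1 in b2 *; lra.
Qed.

Lemma mobius_powers_unbounded M :
  ~ (forall n, exists c, mobius_pow_coeffs M n c).
Proof.
have rho0 : 0 < rho by []; have rho1 : rho < 1 by [].
have sub_rev L m i : (i < L)%N -> (L <= m)%N ->
    (m - (L - i.+1) = m.+1 - L + i)%N by lia.
move=> hyp0; pose M1 := M + 1.
have hyp n : exists c, mobius_pow_coeffs M1 n c.
  have [c [c1 c2]] := hyp0 n; exists c; split=> // N.
  by apply: le_trans (c1 N) _; rewrite lerDl.
have M0 : 0 <= M by have [c [/(_ 0%N)]] := hyp0 0%N; rewrite big_ord0.
have M11 : 1 <= M1 by rewrite lerDr.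
clearbody M1; clear hyp0 M0 M; rename M1 into M.
have [delta d0 hdelta] : exists2 delta : R, 0 < delta & forall n c,
    mobius_pow_coeffs M n c -> exists m, delta <= cabs (c m).
  exists (8 * M)^-1 => [|n c hc]; first by rewrite invr_gt0; lra.
  exact: mobius_coef_large hc M11.
(* The final estimate reads J delta / 2 <= 4 M, which this choice contradicts. *)
pose J := (Num.bound (8 * M / delta)).+1.
have hJ : 8 * M < J%:R * delta.
  rewrite -ltr_pdivrMr //; apply: lt_trans (_ : _ < (Num.bound (8 * M / delta))%:R) _.
    by apply: archi_boundP; rewrite divr_ge0 //; lra.
  by rewrite ltr_nat.
(* This bounds |2 kap| independently of [n]: [mobius_large_index] gives n (1 - rho^2) <= 5 M m0 /
   delta for m0 >= 1, and 1 + rho^2 <= 2. *)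
pose Kb := (5 * M / delta + 2) / rho.
have Kb0 : 0 <= Kb.
  by apply: divr_ge0; [apply: addr_ge0 => //; apply: divr_ge0; lra | exact: ltW].
pose Gs := \sum_(j < J.*2.+1) cheb_error Kb j.
have Gs0 : 0 <= Gs by rewrite sumr_ge0 // => j _; apply: cheb_error_ge0.
have err_le j : (j <= J.*2)%N -> cheb_error Kb j <= Gs.
  move=> jJ; rewrite /Gs (bigD1 (Ordinal (jJ : (j < J.*2.+1)%N))) //= lerDl.
  by rewrite sumr_ge0 // => i _; apply: cheb_error_ge0.
pose D : R := J.*2%:R.
(* An index [m0] above [W] keeps the window of radius [J.*2] around it within the natural numbers
   and makes the accumulated error [Gs * eta] at most delta / 4. The next choice, of [n], forces
   [m0] above [W]. *)
pose W := (Num.bound (16 * (D + 1) * M * Gs / (rho * delta)) + J.*2.+1)%N.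
have r2 : 0 < 1 - rho ^+ 2 by rewrite subr_gt0 expr_lt1 // ltW.
pose n := Num.bound ((4 * W%:R + 1) * M / ((1 - rho ^+ 2) * delta)).
have hn : (4 * W%:R + 1) * M < n%:R * (1 - rho ^+ 2) * delta.
  have den0 : 0 < (1 - rho ^+ 2) * delta by rewrite mulr_gt0.
  rewrite -mulrA -ltr_pdivrMr //; apply: archi_boundP.
  apply: divr_ge0; last exact: ltW.
  by apply: mulr_ge0; [rewrite addr_ge0 // mulr_ge0 | lra].
have [c hc] := hyp n.
have [m0 hm0] := hdelta n c hc.
have big := mobius_large_index hc hm0.
have Wm0 : (W < m0)%N.
  have := lt_le_trans hn big; rewrite ltr_pM2r; last by lra.
  by rewrite ltrD2r ltr_pM2l // ltr_nat.
have m0J : (J.*2 < m0)%N by apply: leq_ltn_trans Wm0; apply: ltnW; apply: leq_addl.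
have m0_gt0 : (0 < m0)%N by apply: leq_ltn_trans m0J.
have m0R : 1 <= m0%:R :> R by rewrite ler1n.
pose kap := (n%:R * (1 - rho ^+ 2) - (1 + rho ^+ 2) * m0%:R) / (2 * rho * m0%:R).
pose eta := 4 * (D + 1) * M / (rho * m0%:R).
have D0 : 0 <= D by rewrite /D.
have eta0 : 0 <= eta by apply: divr_ge0; do ?apply: mulr_ge0 => //; lra.
have etaG : Gs * eta <= delta / 4.
  have h : 16 * (D + 1) * M * Gs / (rho * delta) <= m0%:R.
    apply: ltW; apply: lt_trans (_ : _ < (Num.bound (16 * (D + 1) * M * Gs / (rho * delta)))%:R) _.
      by apply: archi_boundP; apply: divr_ge0; do ?apply: mulr_ge0 => //; lra.
    by rewrite ltr_nat; apply: leq_ltn_trans Wm0; rewrite leq_addr.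
  rewrite ler_pdivrMr ?mulr_gt0 // in h.
  rewrite mulrA ler_pdivrMr ?mulr_gt0 //; last by lra.
  lra.
have kapb : `|2 * kap| <= Kb.
  have -> : 2 * kap = (n%:R * (1 - rho ^+ 2) - (1 + rho ^+ 2) * m0%:R) / (rho * m0%:R).
    by rewrite /kap; field; rewrite !gt_eqF //; lra.
  rewrite normrM normfV [X in _ / X]gtr0_norm ?mulr_gt0 //; last by lra.
  rewrite ler_pdivrMr ?mulr_gt0 //; last by lra.
  have -> : Kb * (rho * m0%:R) = (5 * M / delta + 2) * m0%:R.
    by rewrite /Kb; field; rewrite !gt_eqF.
  have e1 : n%:R * (1 - rho ^+ 2) <= (4 * m0%:R + 1) * M / delta by rewrite ler_pdivlMr.
  have e2 : (4 * m0%:R + 1) * M / delta <= 5 * M / delta * m0%:R.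
    rewrite [X in _ <= X]mulrAC ler_pM2r ?invr_gt0 //; nra.
  have e3 : 0 <= n%:R * (1 - rho ^+ 2) by rewrite mulr_ge0 // ltW.
  have e4 : rho ^+ 2 * m0%:R <= m0%:R by rewrite ler_piMl //; lra.
  have e5 : 0 <= rho ^+ 2 * m0%:R by rewrite mulr_ge0 ?sqr_ge0.
  rewrite ler_norml; apply/andP; split; lra.
pose s j : C := c (m0 + j)%N + c (m0 - j)%N.
have s_cheb : forall j, (j <= J.*2)%N -> cabs (s j - 2 * (cheb kap j)%:C * c m0) <= cheb_error Kb j * eta.
  apply: cheb_perturbed => //.
  - by rewrite /s addn0 subn0; ring.
  - rewrite /s addn1 subn1; apply: mobius_window_step => //.
    by rewrite subrr normr0.
  move=> j jJ; have jm : (j.+1 < m0)%N by apply: leq_ltn_trans m0J.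
  have h1 : cabs (c (m0 + j.+1).+1 + c (m0 + j.+1).-1 - 2 * kap%:C * c (m0 + j.+1)%N) <= eta.
    apply: mobius_window_step => //; first by rewrite addnS.
    by rewrite natrD addrAC subrr add0r normr_nat ler_nat.
  have h2 : cabs (c (m0 - j.+1).+1 + c (m0 - j.+1).-1 - 2 * kap%:C * c (m0 - j.+1)%N) <= eta.
    apply: mobius_window_step => //; first by rewrite subn_gt0.
    by rewrite natrB ?(ltnW jm) // addrAC subrr add0r normrN normr_nat ler_nat.
  have -> : s j.+2 + s j - 2 * kap%:C * s j.+1 =
     (c (m0 + j.+1).+1 + c (m0 + j.+1).-1 - 2 * kap%:C * c (m0 + j.+1)%N) +
     (c (m0 - j.+1).+1 + c (m0 - j.+1).-1 - 2 * kap%:C * c (m0 - j.+1)%N).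
    have -> : (m0 - j.+1).+1 = (m0 - j)%N by rewrite subnSK // ltnW.
    have -> : (m0 - j.+1).-1 = (m0 - j.+2)%N by rewrite -subnS.
    by rewrite /s !addnS /=; ring.
  by apply: le_trans (cabsD _ _) _; lra.
(* The Chebyshev main terms add up to at least [delta], and each of the two errors removes at most
   delta / 4. *)
have s_low j : (j < J)%N -> delta / 2 <= cabs (s j) + cabs (s j.*2).
  move=> jJ; have j2 : (j.*2 <= J.*2)%N by rewrite leq_double ltnW.
  have j1 : (j <= J.*2)%N by apply: leq_trans j2; rewrite -addnn leq_addr.
  have h1 := s_cheb j j1; have h2 := s_cheb _ j2.
  have g1 : cheb_error Kb j * eta <= Gs * eta by rewrite ler_wpM2r ?err_le.
  have g2 : cheb_error Kb j.*2 * eta <= Gs * eta by rewrite ler_wpM2r ?err_le.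
  have t (t : R) : cabs (2 * t%:C * c m0) = 2 * `|t| * cabs (c m0).
    by rewrite !cabsM cabs_nat cabs_real.
  have q1 := cabs_rtri (2 * (cheb kap j)%:C * c m0) (s j).
  have q2 := cabs_rtri (2 * (cheb kap j.*2)%:C * c m0) (s j.*2).
  rewrite cabs_sym t in q1; rewrite cabs_sym t in q2.
  have lw := cheb_double_lower kap j.
  have : delta <= 2 * `|cheb kap j| * cabs (c m0) + 2 * `|cheb kap j.*2| * cabs (c m0).
    rewrite -mulrDl -mulrDr; apply: le_trans hm0 _.
    by rewrite ler_peMl ?cabs_ge0 //; lra.
  lra.
have s_sum : \sum_(i < J.*2) cabs (s i) <= 2 * M.
  apply: le_trans (_ : \sum_(i < J.*2) (cabs (c (m0 + i)%N) + cabs (c (m0 - i)%N)) <= _).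
    by apply: ler_sum => i _; apply: cabsD.
  rewrite big_split /=.
  have u1 : \sum_(i < J.*2) cabs (c (m0 + i)%N) <= M.
    apply: le_trans (hc.1 (m0 + J.*2)%N); rewrite big_split_ord /= lerDr.
    by rewrite sumr_ge0 // => i _; apply: cabs_ge0.
  have u2 : \sum_(i < J.*2) cabs (c (m0 - i)%N) <= M.
    apply: le_trans (hc.1 m0.+1).
    rewrite (reindex_inj rev_ord_inj) /=.
    apply: le_trans (_ : \sum_(i < J.*2) cabs (c (m0.+1 - J.*2 + i)%N) <= _).
      by apply: ler_sum => i _; rewrite sub_rev // ltnW.
    have e : (m0.+1 = (m0.+1 - J.*2) + J.*2)%N by rewrite subnK // ltnW // ltnS ltnW.
    rewrite [X in _ <= X](_ : _ = \sum_(m < (m0.+1 - J.*2) + J.*2) cabs (c m)); last by rewrite -e.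
    rewrite big_split_ord /= lerDr.
    by rewrite sumr_ge0 // => i _; apply: cabs_ge0.
  lra.
have s_ge0 i : 0 <= cabs (s i) by apply: cabs_ge0.
have f1 := sum_double_le J s_ge0; have f2 := sum_double_idx_le J s_ge0.
have : J%:R * (delta / 2) <= \sum_(j < J) (cabs (s j) + cabs (s j.*2)).
  apply: le_trans (_ : \sum_(j < J) delta / 2 <= _).
    by rewrite sumr_const card_ord mulr_natl.
  by apply: ler_sum => j _; apply: s_low.
rewrite big_split /=; lra.
Qed.

End MobiusPowersUnbounded.

(** * The algebra A+ *)

Section BoxSums.
Variable k : nat.
Local Notation mindex := (mindex k).

Definition in_box N (n : mindex) : bool := [forall i, (n i < N)%N].

Lemma in_boxP N (n : mindex) : reflect (forall i, (n i < N)%N) (in_box N n).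
Proof. exact: forallP. Qed.

Definition mval N (m : {ffun 'I_k -> 'I_N}) : mindex := fun i => m i.

Lemma mval_inj N : injective (@mval N).
Proof.
by move=> m m' h; apply/ffunP=> i; apply: val_inj; apply: (congr1 (fun u => u i) h).
Qed.

Lemma mval_in_box N (m : {ffun 'I_k -> 'I_N}) : in_box N (mval m).
Proof. by apply/in_boxP => i; apply: ltn_ord. Qed.

Lemma in_box_mval N (n : mindex) : in_box N n ->
  exists m : {ffun 'I_k -> 'I_N}, mval m = n.
Proof.
move=> /in_boxP h; exists [ffun i => Ordinal (h i)].
by apply: funext => i; rewrite /mval ffunE.
Qed.

Lemma box_sumE (V : nmodType) N (F : mindex -> V) :
  box_sum N F = \sum_(m : {ffun 'I_k -> 'I_N}) F (mval m).
Proof. by []. Qed.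

(** Boxes of different sides are indexed by different types; here the smaller sum is rewritten over
    the larger index type, so that differences can be taken term by term. *)
Lemma box_sum_widen (V : nmodType) N N' (F : mindex -> V) : (N <= N')%N ->
  box_sum N F =
  \sum_(m : {ffun 'I_k -> 'I_N'} | in_box N (mval m)) F (mval m).
Proof.
move=> NN'; pose h (m : {ffun 'I_k -> 'I_N}) : {ffun 'I_k -> 'I_N'} :=
  [ffun i => widen_ord NN' (m i)].
have hE m : mval (h m) = mval m by apply: funext => i; rewrite /mval ffunE.
have hinj : injective h by move=> m m' e; apply: mval_inj; rewrite -!hE e.
rewrite box_sumE; under eq_bigr => m _ do rewrite -hE.
rewrite -(@big_imset _ _ _ _ _ h predT (fun m => F (mval m))) => [|? ? _ _ /hinj //].
apply: eq_bigl => m; apply/imsetP/idP => [[m' _ ->]|].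
  by rewrite hE mval_in_box.
by case/in_box_mval=> m' e; exists m' => //; apply: mval_inj; rewrite hE.
Qed.

Lemma eq_box_sum (V : nmodType) N (F G : mindex -> V) :
  (forall n, F n = G n) -> box_sum N F = box_sum N G.
Proof. by move=> h; apply: eq_bigr. Qed.

Lemma box_sumD (V : nmodType) N (F G : mindex -> V) :
  box_sum N (fun n => F n + G n) = box_sum N F + box_sum N G.
Proof. exact: big_split. Qed.

Lemma box_sum_supp (V : nmodType) S N (F : mindex -> V) :
  (forall n, F n <> 0 -> in_box S n /\ in_box N n) -> box_sum S F = box_sum N F.
Proof.
wlog SN : S N / (S <= N)%N => [H|] hF.
  case: (leqP S N) => [|/ltnW] h; first exact: H.
  by rewrite (H N S) // => n /hF[].
rewrite (box_sum_widen _ SN) box_sumE big_mkcond; apply: eq_bigr => m _.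
by case: ifPn => // /negP h; apply: contrapT => e; apply: h; case: (hF (mval m)) => // e'; apply: e.
Qed.

Lemma box_sum_axis (V : nmodType) (i : 'I_k) N (F : mindex -> V) :
  (forall n j, j != i -> n j <> 0%N -> F n = 0) ->
  box_sum N F = \sum_(t < N) F (fun j => if j == i then nat_of_ord t else 0%N).
Proof.
move=> hF; case: N => [|N].
  by rewrite big_ord0 box_sumE big1 // => m _; case: (m i).
pose h (t : 'I_N.+1) : {ffun 'I_k -> 'I_N.+1} := [ffun j => if j == i then t else ord0].
have hE t : mval (h t) = fun j => if j == i then nat_of_ord t else 0%N.
  by apply: funext => j; rewrite /mval ffunE; case: ifP.
have hinj : injective h.
  by move=> t t' /ffunP/(_ i); rewrite !ffunE eqxx.
under [RHS]eq_bigr => t _ do rewrite -hE.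
rewrite -(@big_imset _ _ _ _ _ h predT (fun m => F (mval m))) => [|? ? _ _ /hinj //].
rewrite box_sumE [RHS]big_mkcond; apply: eq_bigr => m _.
case: ifPn => // /imsetP hm.
case: (pselect (exists j, j != i /\ nat_of_ord (m j) <> 0%N)) => [[j [ji mj]]|none].
  exact: hF mj.
case: hm; exists (m i) => //; apply: mval_inj; rewrite hE; apply: funext => j.
case: eqVneq => [->//|ji]; apply: contrapT => mj; apply: none.
by exists j.
Qed.

(** The coefficients of the Cauchy product. Every pair with p + q = n lies in the box of side [S],
    and the test selects exactly those pairs. *)
Definition conv (A : pzRingType) (u v : mindex -> A) (n : mindex) : A :=
  let S := (\sum_i n i).+1 in
  box_sum S (fun p => box_sum S (fun q =>
    if [forall i, (p i + q i)%N == n i] then u p * v q else 0)).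

(** After exchanging the sums, each pair (p, q) meets exactly one n, namely p + q, and is counted
    when that index lies in the box. *)
Lemma box_sum_conv (A : pzRingType) (u v : mindex -> A) N :
  box_sum N (conv u v) = box_sum N (fun p => box_sum N (fun q =>
    if in_box N (fun i => (p i + q i)%N) then u p * v q else 0)).
Proof.
transitivity (box_sum N (fun n => box_sum N (fun p => box_sum N (fun q =>
    if [forall i, (p i + q i)%N == n i] then u p * v q else 0)))).
  rewrite !box_sumE; apply: eq_bigr => m _; rewrite /conv.
  set n := mval m; set S := _.+1.
  have nN i : (n i < N)%N by apply: ltn_ord.
  have nS i : (n i < S)%N by rewrite ltnS /S (bigD1 i) //= leq_addr.
  have sq p : box_sum S (fun q => if [forall i, (p i + q i)%N == n i] then u p * v q else 0)
            = box_sum N (fun q => if [forall i, (p i + q i)%N == n i] then u p * v q else 0).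
    apply: box_sum_supp => q; case: ifP => // /forallP h _.
    split; apply/in_boxP => i; have /eqP e := h i.
      by apply: leq_ltn_trans (nS i); rewrite -e leq_addl.
    by apply: leq_ltn_trans (nN i); rewrite -e leq_addl.
  under eq_box_sum => p do rewrite sq.
  apply: box_sum_supp => p np.
  suff h i : (p i <= n i)%N.
    split; apply/in_boxP => i; [exact: leq_ltn_trans (nS i) | exact: leq_ltn_trans (nN i)].
  apply: contrapT => h; apply: np; rewrite box_sumE big1 // => q _.
  case: ifP => // /forallP/(_ i)/eqP e; case: h.
  by rewrite -e leq_addr.
rewrite !box_sumE exchange_big; apply: eq_bigr => p _ /=.
rewrite !box_sumE exchange_big; apply: eq_bigr => q _ /=.
case: ifPn => [/in_box_mval[m0 e0]|nb].
  rewrite (bigD1 m0) //= e0 big1 ?addr0 => [|m ne].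
    by case: ifPn => // /forallP[] i.
  case: ifP => // /forallP h; case/eqP: ne; apply: mval_inj; rewrite e0.
  by apply: funext => i; rewrite -(eqP (h i)).
apply: big1 => m _; case: ifP => // /forallP h; case/negP: nb.
by apply/in_boxP => i; rewrite (eqP (h i)); apply: ltn_ord.
Qed.

End BoxSums.

(** * Absolutely convergent series on the polydisc: uniform convergence, sums and products *)

Section BoxEstimates.
Variables (R : realType) (k : nat).
Local Notation C := R[i].
Local Notation mindex := (mindex k).
Local Notation cpoint := (@cpoint R k).
Implicit Types (F G : mindex -> C) (H : mindex -> R) (f g : cpoint -> C).

Lemma box_sum_ge0 N H : (forall n, 0 <= H n) -> 0 <= box_sum N H.
Proof. by move=> h; apply: sumr_ge0 => m _; apply: h. Qed.

Lemma box_sum_le N H H' : (forall n, H n <= H' n) -> box_sum N H <= box_sum N H'.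
Proof. by move=> h; apply: ler_sum => m _; apply: h. Qed.

Lemma box_sum_mono N N' H : (forall n, 0 <= H n) -> (N <= N')%N ->
  box_sum N H <= box_sum N' H.
Proof.
move=> h NN'; rewrite (box_sum_widen _ NN') box_sumE big_mkcond.
by apply: ler_sum => m _; case: ifP.
Qed.

Lemma box_sum_diff N N' F H : (N <= N')%N -> (forall n, cabs (F n) <= H n) ->
  cabs (box_sum N' F - box_sum N F) <= box_sum N' H - box_sum N H.
Proof.
move=> NN' h; rewrite !(box_sum_widen _ NN') !box_sumE.
rewrite (bigID (fun m => in_box N (mval m))) /= addrAC subrr add0r.
rewrite [X in _ <= X - _](bigID (fun m => in_box N (mval m))) /= addrAC subrr add0r.
by apply: le_trans (cabs_sum _ _ _) _; apply: ler_sum => m _.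
Qed.

Lemma cabs_monomial_le1 (z : cpoint) n : in_closed_polydisc z -> cabs (monomial z n) <= 1.
Proof.
move=> hz; rewrite cabs_prod; apply: prodr_ile1 => i _.
by rewrite cabsX exprn_ge0 ?cabs_ge0 //= exprn_ile1 ?cabs_ge0.
Qed.

Lemma open_closed_polydisc (z : cpoint) : in_open_polydisc z -> in_closed_polydisc z.
Proof. by move=> h i; apply: ltW. Qed.

Lemma coeffs_term_le (a : mindex -> C) (z : cpoint) n :
  in_closed_polydisc z -> cabs (a n * monomial z n) <= cabs (a n).
Proof.
by move=> hz; rewrite cabsM ler_piMr ?cabs_ge0 ?cabs_monomial_le1.
Qed.

Lemma abs_summable_tail (a : mindex -> C) : abs_summable a ->
  forall e, 0 < e -> exists K, forall N, (K <= N)%N ->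
  box_sum N (fun n => cabs (a n)) - box_sum K (fun n => cabs (a n)) <= e.
Proof.
case=> M hM e e0; apply: nondecreasing_bounded_tail hM e e0 => m n mn.
by apply: box_sum_mono mn => *; apply: cabs_ge0.
Qed.

Lemma Aplus_uniform f a : Aplus_coeffs f a ->
  forall e, 0 < e -> exists K, forall N, (K <= N)%N -> forall z, in_closed_polydisc z ->
  cabs (f z - box_sum N (fun n => a n * monomial z n)) <= e.
Proof.
case=> sa hf e e0; have [K hK] := abs_summable_tail sa e0.
exists K => N KN z hz; apply: (converges_to_le (N1 := N)) (hf z hz) _ => N' NN'.
apply: le_trans (box_sum_diff NN' (fun n => coeffs_term_le a n hz)) _.
apply: le_trans (hK N' (leq_trans KN NN')); rewrite lerD2l lerN2.
by apply: box_sum_mono KN => *; apply: cabs_ge0.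
Qed.

Lemma Aplus_ext f g a : (forall z, in_closed_polydisc z -> f z = g z) ->
  Aplus_coeffs f a -> Aplus_coeffs g a.
Proof. by move=> fg [sa hf]; split=> // z hz; rewrite -fg //; apply: hf. Qed.

Lemma Aplus_add f g a b : Aplus_coeffs f a -> Aplus_coeffs g b ->
  Aplus_coeffs (fun z => f z + g z) (fun n => a n + b n).
Proof.
move=> [[A hA] hf] [[B hB] hg]; split=> [|z hz e e0].
  exists (A + B) => N; apply: le_trans (lerD (hA N) (hB N)).
  by rewrite -box_sumD; apply: box_sum_le => n; apply: cabsD.
have e2 : 0 < e / 2 by rewrite divr_gt0.
have [N1 h1] := hf z hz _ e2; have [N2 h2] := hg z hz _ e2.
exists (maxn N1 N2) => N; rewrite geq_max => /andP[/h1 {}h1 /h2 {}h2].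
rewrite (_ : box_sum N _ = box_sum N (fun n => a n * monomial z n) +
                           box_sum N (fun n => b n * monomial z n)); last first.
  by rewrite -box_sumD; apply: eq_box_sum => n; rewrite mulrDl.
rewrite opprD addrACA; apply: le_lt_trans (cabsD _ _) _.
by rewrite [e]splitr ltrD.
Qed.

Lemma monomial_conv (a b : mindex -> C) (z : cpoint) n :
  conv a b n * monomial z n =
  conv (fun n => a n * monomial z n) (fun n => b n * monomial z n) n.
Proof.
rewrite /conv !box_sumE mulr_suml; apply: eq_bigr => p _.
rewrite !box_sumE mulr_suml; apply: eq_bigr => q _.
case: ifP => [/forallP h|]; last by rewrite mul0r.
have -> : monomial z n = monomial z (mval p) * monomial z (mval q).
  rewrite /monomial -big_split; apply: eq_bigr => i _ /=.
  by rewrite -exprD (eqP (h i)).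
ring.
Qed.

Lemma cabs_conv (a b : mindex -> C) n :
  cabs (conv a b n) <= conv (fun n => cabs (a n)) (fun n => cabs (b n)) n.
Proof.
rewrite /conv !box_sumE; apply: le_trans (cabs_sum _ _ _) _; apply: ler_sum => p _.
rewrite !box_sumE; apply: le_trans (cabs_sum _ _ _) _; apply: ler_sum => q _.
by case: ifP; rewrite ?cabsM ?cabs0.
Qed.

(** A Mertens argument: the product of box sums is compared with the box sum of the Cauchy product,
    and the discrepancy is a tail of the product of the two absolute series. *)
Lemma Aplus_mul f g a b : Aplus_coeffs f a -> Aplus_coeffs g b ->
  Aplus_coeffs (fun z => f z * g z) (conv a b).
Proof.
move=> [[A hA] hf] [[B hB] hg].
pose al N := box_sum N (fun n => cabs (a n)).
pose be N := box_sum N (fun n => cabs (b n)).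
have al0 N : 0 <= al N by apply: box_sum_ge0 => n; apply: cabs_ge0.
have be0 N : 0 <= be N by apply: box_sum_ge0 => n; apply: cabs_ge0.
have albe N : al N * be N <= A * B by apply: ler_pM; rewrite ?hA ?hB.
have mono m n : (m <= n)%N -> al m * be m <= al n * be n.
  by move=> mn; apply: ler_pM; rewrite ?box_sum_mono // => n'; apply: cabs_ge0.
split=> [|z hz].
  exists (A * B) => N; apply: le_trans (box_sum_le N (cabs_conv a b)) _.
  apply: le_trans (albe N); rewrite box_sum_conv /al /be !box_sumE mulr_suml.
  apply: ler_sum => p _; rewrite mulr_sumr; apply: ler_sum => q _.
  by case: ifP => // _; rewrite mulr_ge0 ?cabs_ge0.
(* A pair missing from the Cauchy sum has p + q outside the box of side [N], so p and q cannot both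
   lie in the box of side [K]. *)
have key N K : (K.*2 <= N)%N ->
   cabs (box_sum N (fun n => a n * monomial z n) * box_sum N (fun n => b n * monomial z n)
         - box_sum N (fun n => conv a b n * monomial z n)) <= al N * be N - al K * be K.
  move=> KN; have KN' : (K <= N)%N by apply: leq_trans KN; rewrite -addnn leq_addr.
  under [X in _ - X]eq_box_sum => n do rewrite monomial_conv.
  rewrite box_sum_conv [al K]/al [be K]/be !(box_sum_widen _ KN') /al /be !box_sumE.
  rewrite [\sum_(m | in_box K (mval m)) cabs (a (mval m))]big_mkcond.
  rewrite [\sum_(m | in_box K (mval m)) cabs (b (mval m))]big_mkcond /=.
  rewrite !mulr_suml -!sumrB; apply: le_trans (cabs_sum _ _ _) _.
  apply: ler_sum => p _; rewrite !mulr_sumr box_sumE -!sumrB.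
  apply: le_trans (cabs_sum _ _ _) _; apply: ler_sum => q _.
  case: ifPn => [_|npq].
    rewrite subrr cabs0 subr_ge0.
    by case: ifP => _; case: ifP => _; rewrite ?mul0r ?mulr0 ?mulr_ge0 ?cabs_ge0.
  rewrite subr0 cabsM; apply: le_trans (_ : cabs (a (mval p)) * cabs (b (mval q)) <= _).
    by rewrite ler_pM ?cabs_ge0 ?coeffs_term_le.
  case: ifPn => pK; last by rewrite mul0r subr0.
  case: ifPn => qK; last by rewrite mulr0 subr0.
  case/negP: npq; apply/in_boxP => i; apply: leq_trans KN; rewrite -addnn.
  by have := in_boxP _ _ pK i; have := in_boxP _ _ qK i; lia.
move=> e e0; have e2 : 0 < e / 2 by rewrite divr_gt0.
have [K hK] := nondecreasing_bounded_tail mono albe e2.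
pose Bf := cabs (f z) + 1; pose Bg := cabs (g z) + 1.
have Bf0 : 0 < Bf by rewrite ltr_wpDl ?cabs_ge0.
have Bg0 : 0 < Bg by rewrite ltr_wpDl ?cabs_ge0.
(* The 1 in the minimum gives |u| <= [Bf]; the other thresholds make each of the two product errors
   smaller than e / 4. *)
have ef : 0 < Num.min 1 (e / (4 * Bg)) by rewrite lt_min ltr01 divr_gt0 ?mulr_gt0.
have eg : 0 < e / (4 * Bf) by rewrite divr_gt0 ?mulr_gt0.
have [N1 h1] := hf z hz _ ef; have [N2 h2] := hg z hz _ eg.
exists (maxn K.*2 (maxn N1 N2)) => N; rewrite !geq_max => /and3P[NK /h1 {}h1 /h2 {}h2].
have NK' : (K <= N)%N by apply: leq_trans NK; rewrite -addnn leq_addr.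
have h3 := key N K NK; have h4 := hK N NK'.
set u := box_sum N (fun n => a n * _) in h1 h3.
set v := box_sum N (fun n => b n * _) in h2 h3.
rewrite lt_min in h1; case/andP: h1 => h1 h1'.
rewrite ltr_pdivlMr ?mulr_gt0 // in h1'; rewrite ltr_pdivlMr ?mulr_gt0 // in h2.
apply: le_lt_trans (cabs_tri (u * v) _ _) _; rewrite cabs_sym.
have -> : u * v - f z * g z = u * (v - g z) + (u - f z) * g z by ring.
have := cabsD (u * (v - g z)) ((u - f z) * g z); rewrite !cabsM => h5.
have h6 : cabs u <= Bf.
  by have := cabs_rtri u (f z); rewrite /Bf; lra.
have h7 : cabs u * cabs (v - g z) <= Bf * cabs (v - g z) by rewrite ler_wpM2r ?cabs_ge0.
have h8 : cabs (u - f z) * cabs (g z) <= cabs (u - f z) * Bg.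
  by rewrite ler_wpM2l ?cabs_ge0 // /Bg; lra.
lra.
Qed.

End BoxEstimates.

(** * Geometric series, uniformly on the closed disc *)

Section GeometricTail.
Variable R : realType.
Local Notation C := R[i].

Lemma pow_small (r e : R) : 0 <= r -> r < 1 -> 0 < e -> exists N, r ^+ N <= e.
Proof.
move=> r0 r1 e0; apply: contrapT => h.
have {}h N : e < r ^+ N by rewrite ltNge; apply/negP => hN; apply: h; exists N.
have rp : 0 < r.
  by rewrite lt_neqAle r0 andbT eq_sym; apply/eqP => z; have := h 1%N; rewrite z expr1; lra.
have : r^-1 <= 1.
  apply: (@pow_bounded_le1 _ _ e^-1) => [|n]; first by rewrite invr_ge0.
  by rewrite exprVn lef_pV2 ?posrE ?exprn_gt0 // ltW.
by rewrite invf_le1 // leNgt r1.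
Qed.

Lemma geom_error (x : C) N : cabs x < 1 ->
  cabs ((1 - x)^-1 - \sum_(m < N) x ^+ m) <= cabs x ^+ N / (1 - cabs x).
Proof.
move=> x1; have h1 : 1 - cabs x <= cabs (1 - x).
  by have := cabs_rtri 1 x; rewrite cabs1.
have d0 : 0 < cabs (1 - x) by apply: lt_le_trans h1; rewrite subr_gt0.
have -> : (1 - x)^-1 - \sum_(m < N) x ^+ m = x ^+ N / (1 - x).
  have nz : 1 - x != 0 by rewrite -cabs_gt0.
  apply: (mulIf nz); rewrite divfK // mulrBl mulVf //.
  have : (1 - x) * \sum_(m < N) x ^+ m = 1 - x ^+ N.
    by rewrite -opprB mulNr -subrX1 opprB.
  by rewrite mulrC => ->; rewrite opprB addrC subrK.
rewrite cabs_div cabsX ler_wpM2l ?exprn_ge0 ?cabs_ge0 //.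
by rewrite lef_pV2 ?posrE // subr_gt0.
Qed.

Lemma geom_uniform (c : C) (e : R) : cabs c < 1 -> 0 < e ->
  exists K, forall N, (K <= N)%N -> forall z, cabs z <= 1 ->
  cabs ((1 - c * z)^-1 - \sum_(m < N) c ^+ m * z ^+ m) <= e.
Proof.
move=> c1 e0; have d0 : 0 < 1 - cabs c by rewrite subr_gt0.
have [K hK] := pow_small (cabs_ge0 c) c1 (mulr_gt0 e0 d0).
exists K => N KN z z1.
have cz : cabs (c * z) <= cabs c by rewrite cabsM ler_piMr ?cabs_ge0.
under eq_bigr => m _ do rewrite -exprMn.
apply: le_trans (geom_error N (le_lt_trans cz c1)) _.
rewrite ler_pdivrMr; last by rewrite subr_gt0 (le_lt_trans cz).
apply: le_trans (_ : e * (1 - cabs c) <= _); last by rewrite ler_pM2l // lerD2l lerN2.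
apply: le_trans hK; apply: le_trans (_ : cabs c ^+ N <= _).
  by rewrite lerXn2r ?nnegrE ?cabs_ge0.
by rewrite ler_wiXn2l ?cabs_ge0 // ltW.
Qed.

End GeometricTail.

(** * The disc algebra *)

Section DiscAlgebra.
Variable R : realType.
Local Notation C := R[i].
Implicit Types (h g : C -> C).

(** Uniform approximability by polynomials is taken as the definition, so that Schwarz's lemma
    passes over from polynomials. *)
Definition disc_algebra h := forall e : R, 0 < e ->
  exists p : {poly C}, forall z, cabs z <= 1 -> cabs (h z - p.[z]) <= e.

Lemma disc_algebra_poly (p : {poly C}) : disc_algebra (fun z => p.[z]).
Proof. by move=> e e0; exists p => z _; rewrite subrr cabs0 ltW. Qed.

Lemma disc_algebra_const (c : C) : disc_algebra (fun=> c).
Proof. by move=> e e0; exists c%:P => z _; rewrite hornerC subrr cabs0 ltW. Qed.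

Lemma disc_algebraD h g : disc_algebra h -> disc_algebra g ->
  disc_algebra (fun z => h z + g z).
Proof.
move=> hh hg e e0; have e2 : 0 < e / 2 by rewrite divr_gt0.
have [p hp] := hh _ e2; have [q hq] := hg _ e2.
exists (p + q) => z z1; rewrite hornerD opprD addrACA.
apply: le_trans (cabsD _ _) _; rewrite [e]splitr lerD ?hp ?hq //.
Qed.

Lemma poly_bounded (p : {poly C}) : exists2 B : R, 0 < B &
  forall z, cabs z <= 1 -> cabs p.[z] <= B.
Proof.
have [K K0 hK] := poly_lipschitz0 p.
exists (K + cabs p.[0] + 1) => [|z z1]; first by have := cabs_ge0 p.[0]; lra.
have z0 : cabs (0 : C) <= 1 by rewrite cabs0.
have := hK z 0 z1 z0; rewrite subr0 => h1.
have : K * cabs z <= K by rewrite ler_piMr.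
have := cabs_rtri p.[z] p.[0]; lra.
Qed.

Lemma disc_algebra_bounded h : disc_algebra h -> exists2 B : R, 0 < B &
  forall z, cabs z <= 1 -> cabs (h z) <= B.
Proof.
move=> hh; have [p hp] := hh 1 ltr01; have [B B0 hB] := poly_bounded p.
exists (B + 1) => [|z z1]; first by lra.
have := hp z z1; have := hB z z1; have := cabs_rtri (h z) p.[z]; lra.
Qed.

Lemma disc_algebraM h g : disc_algebra h -> disc_algebra g ->
  disc_algebra (fun z => h z * g z).
Proof.
move=> hh hg e e0; have [A A0 hA] := disc_algebra_bounded hh.
have [q hq] := hg _ (divr_gt0 e0 (mulr_gt0 (ltr0n R 2) A0)).
have [B B0 hB] := poly_bounded q.
have [p hp] := hh _ (divr_gt0 e0 (mulr_gt0 (ltr0n R 2) B0)).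
exists (p * q) => z z1; rewrite hornerM.
have -> : h z * g z - p.[z] * q.[z] = h z * (g z - q.[z]) + (h z - p.[z]) * q.[z] by ring.
apply: le_trans (cabsD _ _) _; rewrite !cabsM.
have h1 : cabs (h z) * cabs (g z - q.[z]) <= A * (e / (2 * A)).
  by rewrite ler_pM ?cabs_ge0 ?hA ?hq.
have h2 : cabs (h z - p.[z]) * cabs q.[z] <= e / (2 * B) * B.
  by rewrite ler_pM ?cabs_ge0 ?hB ?hp.
have e1 : A * (e / (2 * A)) = e / 2 by field; rewrite gt_eqF.
have e2 : e / (2 * B) * B = e / 2 by field; rewrite gt_eqF.
lra.
Qed.

Lemma disc_algebra_sum (I : finType) (F : I -> C -> C) :
  (forall i, disc_algebra (F i)) -> disc_algebra (fun z => \sum_i F i z).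
Proof.
move=> hF; elim: (index_enum I) => [|i s IH].
  by under eq_fun => z do rewrite big_nil; apply: disc_algebra_const.
by under eq_fun => z do rewrite big_cons; apply: disc_algebraD.
Qed.

Lemma disc_algebra_prod (I : finType) (F : I -> C -> C) :
  (forall i, disc_algebra (F i)) -> disc_algebra (fun z => \prod_i F i z).
Proof.
move=> hF; elim: (index_enum I) => [|i s IH].
  by under eq_fun => z do rewrite big_nil; apply: disc_algebra_const.
by under eq_fun => z do rewrite big_cons; apply: disc_algebraM.
Qed.

Lemma disc_algebraX h n : disc_algebra h -> disc_algebra (fun z => h z ^+ n).
Proof.
move=> hh; elim: n => [|n IH].
  by under eq_fun => z do rewrite expr0; apply: disc_algebra_const.
by under eq_fun => z do rewrite exprS; apply: disc_algebraM.
Qed.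

Lemma disc_algebra_geom (c : C) : cabs c < 1 -> disc_algebra (fun z => (1 - c * z)^-1).
Proof.
move=> c1 e e0; have [K hK] := geom_uniform c1 e0.
exists (\poly_(m < K) c ^+ m) => z z1; rewrite horner_poly; exact: hK.
Qed.

Lemma disc_algebra_limit h :
  (forall e : R, 0 < e -> exists2 g, disc_algebra g &
     forall z, cabs z <= 1 -> cabs (h z - g z) <= e) -> disc_algebra h.
Proof.
move=> hh e e0; have e2 : 0 < e / 2 by rewrite divr_gt0.
have [g /(_ _ e2)[p hp] hg] := hh _ e2; exists p => z z1.
by apply: le_trans (cabs_tri (g z) _ _) _; rewrite [e]splitr lerD ?hp ?hg.
Qed.

(** An approximating polynomial is corrected by its small value at 0; it is then bounded by 1 + e/2
    on the circle, and the polynomial case applies. *)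
Lemma disc_algebra_schwarz h : disc_algebra h -> h 0 = 0 ->
  (forall z, cabs z <= 1 -> cabs (h z) <= 1) ->
  forall z, cabs z <= 1 -> cabs (h z) <= cabs z.
Proof.
move=> hh h0 h1 z z1; apply/ler_addgt0Pl => e e0.
have e4 : 0 < e / 4 by rewrite divr_gt0.
have [p hp] := hh _ e4.
have z0 : cabs (0 : C) <= 1 by rewrite cabs0.
have p0 : cabs p.[0] <= e / 4 by have := hp 0 z0; rewrite h0 sub0r cabsN.
pose q := p - p.[0]%:P.
have qE y : q.[y] = p.[y] - p.[0] by rewrite !hornerE.
have hq y : cabs y <= 1 -> cabs (q.[y] - h y) <= e / 2.
  move=> y1; rewrite qE cabs_sym opprB addrCA addrC.
  apply: le_trans (_ : cabs (h y - p.[y]) + cabs p.[0] <= _).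
    by apply: le_trans (cabsD _ _); rewrite addrAC.
  have := hp y y1; lra.
have q1 y : cabs y = 1 -> cabs q.[y] <= 1 + e / 2.
  move=> y1; have y1' : cabs y <= 1 by rewrite y1.
  by have := hq y y1'; have := h1 y y1'; have := cabs_rtri q.[y] (h y); lra.
have q0 : q.[0] = 0 by rewrite qE subrr.
have := poly_schwarz q0 q1 z1; have := hq z z1.
have := cabs_rtri (h z) q.[z]; rewrite cabs_sym.
have : e / 2 * cabs z <= e / 2 by rewrite ler_piMr // ltW // divr_gt0.
lra.
Qed.

End DiscAlgebra.

(** * Examples in A+, radial approach to the boundary, and Parseval in several variables *)

Section AplusFunctions.
Variables (R : realType) (k : nat).
Local Notation C := R[i].
Local Notation mindex := (mindex k).
Local Notation cpoint := (@cpoint R k).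
Implicit Types (f g : cpoint -> C).

(** Partial sums of [f] along the analytic disc [x] are polynomial expressions in the [x j], and
    they converge uniformly because the disc stays in the closed polydisc. *)
Lemma Aplus_disc_algebra f a (x : 'I_k -> C -> C) : Aplus_coeffs f a ->
  (forall j, disc_algebra (x j)) ->
  (forall j z, cabs z <= 1 -> cabs (x j z) <= 1) ->
  disc_algebra (fun z => f (fun j => x j z)).
Proof.
move=> fa hx x1; apply: disc_algebra_limit => e e0.
have [K hK] := Aplus_uniform fa e0.
exists (fun z => box_sum K (fun n => a n * monomial (fun j => x j z) n)).
  apply: disc_algebra_sum => m; apply: disc_algebraM; first exact: disc_algebra_const.
  by apply: disc_algebra_prod => j; apply: disc_algebraX.
by move=> z z1; apply: hK => // j; apply: x1.
Qed.

Definition axis (i : 'I_k) t : mindex := fun j => if j == i then t else 0%N.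

Definition axis_coeffs (i : 'I_k) (c : nat -> C) (n : mindex) : C :=
  if [forall j, (j != i) ==> (n j == 0%N)] then c (n i) else 0.

Lemma axis_coeffs_axis i c t : axis_coeffs i c (axis i t) = c t.
Proof.
rewrite /axis_coeffs /axis eqxx; case: ifPn => // /forallP[] j.
by case: eqVneq.
Qed.

Lemma axis_coeffs_off i c n j : j != i -> n j <> 0%N -> axis_coeffs i c n = 0.
Proof.
by move=> ji nj; rewrite /axis_coeffs; case: ifP => // /forallP/(_ j); rewrite ji => /eqP.
Qed.

Lemma monomial_axis (z : cpoint) i t : monomial z (axis i t) = z i ^+ t.
Proof.
rewrite /monomial (bigD1 i) //= /axis eqxx big1 ?mulr1 // => j ji.
by rewrite (negbTE ji) expr0.
Qed.

Lemma Aplus_axis (i : 'I_k) (c : nat -> C) (h : C -> C) (M : R) :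
  (forall N, \sum_(m < N) cabs (c m) <= M) ->
  (forall w, cabs w <= 1 -> converges_to (fun N => \sum_(m < N) c m * w ^+ m) (h w)) ->
  Aplus_coeffs (fun z : cpoint => h (z i)) (axis_coeffs i c) /\
  forall N, box_sum N (fun n => cabs (axis_coeffs i c n)) <= M.
Proof.
move=> cM ch.
have bM N : box_sum N (fun n => cabs (axis_coeffs i c n)) <= M.
  rewrite (box_sum_axis (i := i)) => [|n j ji nj]; last by rewrite (axis_coeffs_off c ji nj) cabs0.
  by apply: le_trans (cM N); apply: ler_sum => t _; rewrite axis_coeffs_axis.
split=> //; split=> [|z hz e e0]; first by exists M.
have [N0 h0] := ch (z i) (hz i) e e0; exists N0 => N /h0.
rewrite (box_sum_axis (i := i)) => [|n j ji nj]; last by rewrite (axis_coeffs_off c ji nj) mul0r.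
by under [X in _ -> cabs (X - _) < _]eq_bigr => t _ do rewrite axis_coeffs_axis monomial_axis.
Qed.

Lemma Aplus_pow (i : 'I_k) d : exists a,
  Aplus_coeffs (fun z : cpoint => z i ^+ d) a /\
  forall N, box_sum N (fun n => cabs (a n)) <= 1.
Proof.
pose c m : C := if m == d then 1 else 0.
exists (axis_coeffs i c).
have sumc (F : nat -> C) N : (d < N)%N -> \sum_(m < N) c m * F m = F d.
  move=> dN; rewrite (bigD1 (Ordinal dN)) //= /c eqxx mul1r big1 ?addr0 // => m ne.
  by case: eqP => [e|]; rewrite ?mul0r //; case/eqP: ne; apply: val_inj.
apply: (Aplus_axis i (h := fun w => w ^+ d)) => [N|w w1 e e0].
  apply: (@le_trans _ _ (\sum_(m < N.+1 + d) cabs (c m))).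
    rewrite addSnnS big_split_ord /= lerDl sumr_ge0 // => m _; exact: cabs_ge0.
  have dN : (d < N.+1 + d)%N by rewrite addSn ltnS leq_addl.
  rewrite (bigD1 (Ordinal dN)) //= /c eqxx cabs1 big1 ?addr0 // => m ne.
  by case: eqP => [e|]; rewrite ?cabs0 //; case/eqP: ne; apply: val_inj.
exists d.+1 => N dN; rewrite (sumc (fun m => w ^+ m)) // subrr cabs0 //.
Qed.

Lemma Aplus_coord (i : 'I_k) : in_Aplus (fun z : cpoint => z i).
Proof.
have [a [ha _]] := Aplus_pow i 1; exists a; apply: Aplus_ext ha => z _.
exact: expr1.
Qed.

Lemma Aplus_geom (i : 'I_k) (x : C) : cabs x < 1 ->
  in_Aplus (fun z : cpoint => (1 - x * z i)^-1).
Proof.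
move=> x1; exists (axis_coeffs i (fun m => x ^+ m)).
have [||//] := @Aplus_axis i (fun m => x ^+ m) (fun w => (1 - x * w)^-1) (1 - cabs x)^-1.
  move=> N; under eq_bigr => m _ do rewrite cabsX.
  by rewrite geom_sum_le ?cabs_ge0.
move=> w w1 e e0; have e2 : 0 < e / 2 by rewrite divr_gt0.
have [K hK] := geom_uniform x1 e2; exists K => N KN; rewrite cabs_sym.
by apply: le_lt_trans (hK N KN w w1) _; lra.
Qed.

Lemma in_Aplus_const (i : 'I_k) (x : C) : in_Aplus (fun z : cpoint => x).
Proof.
pose c m : C := if m == 0%N then x else 0.
have sumc (F : nat -> C) N : \sum_(m < N.+1) c m * F m = x * F 0%N.
  by rewrite big_ord_recl /= /c eqxx big1 ?addr0 // => m _; rewrite mul0r.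
exists (axis_coeffs i c).
have [||//] := @Aplus_axis i c (fun=> x) (cabs x).
  case=> [|N]; first by rewrite big_ord0 cabs_ge0.
  by rewrite big_ord_recl /= /c eqxx big1 ?addr0 // => m _; exact: cabs0.
by move=> w w1 e e0; exists 1%N => -[//|N] _; rewrite sumc expr0 mulr1 subrr cabs0.
Qed.

Lemma in_AplusD f g : in_Aplus f -> in_Aplus g -> in_Aplus (fun z => f z + g z).
Proof. by move=> [a ha] [b hb]; exists (fun n => a n + b n); apply: Aplus_add. Qed.

Lemma in_AplusM f g : in_Aplus f -> in_Aplus g -> in_Aplus (fun z => f z * g z).
Proof. by move=> [a ha] [b hb]; exists (conv a b); apply: Aplus_mul. Qed.

(** The slice w -> f(w z) lies in the disc algebra; a polynomial approximating it is Lipschitz,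
    which compares w = 1 with w = 1 - d. This transfers facts from the open polydisc to the closed
    one. *)
Lemma Aplus_radial f a (z : cpoint) : Aplus_coeffs f a -> in_closed_polydisc z ->
  forall e : R, 0 < e -> exists r : R,
    [/\ 0 <= r, r < 1 & cabs (f z - f (fun i => r%:C * z i)) <= e].
Proof.
move=> fa hz e e0.
have hx (j : 'I_k) : disc_algebra (fun w : C => z j * w).
  have := disc_algebra_poly ((z j)%:P * 'X).
  by under [X in disc_algebra X -> _]eq_fun => w do rewrite !hornerE.
have x1 (j : 'I_k) w : cabs w <= 1 -> cabs (z j * w) <= 1.
  by move=> w1; rewrite cabsM mulr_ile1 ?cabs_ge0.
have e4 : 0 < e / 4 by rewrite divr_gt0.
have [p hp] := Aplus_disc_algebra fa hx x1 e4.
have [L L0 hL] := poly_lipschitz0 p.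
pose d := Num.min 1 (e / (2 * (L + 1))).
have L1 : 0 < 2 * (L + 1) by lra.
have d0 : 0 < d by rewrite lt_min ltr01 divr_gt0.
have d1 : d <= 1 by rewrite ge_min lexx.
have de : d <= e / (2 * (L + 1)) by rewrite ge_min lexx orbT.
rewrite ler_pdivlMr // in de.
exists (1 - d); split; [by lra | by lra|].
have cr : cabs (1 - d)%:C <= 1 by rewrite cabs_real ger0_norm; lra.
have c1 : cabs (1 : C) <= 1 by rewrite cabs1.
have h1 := hp 1 c1; have h2 := hp _ cr; have h3 := hL 1 _ c1 cr.
have -> : f z = f (fun j => z j * 1) by congr f; apply: funext => j; rewrite mulr1.
have -> : (fun i => (1 - d)%:C * z i) = (fun j => z j * (1 - d)%:C).
  by apply: funext => j; rewrite mulrC.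
have e1 : cabs ((1 : C) - (1 - d)%:C) = d.
  by rewrite rmorphB rmorph1 opprB addrC subrK cabs_real gtr0_norm.
rewrite e1 in h3.
apply: le_trans (cabs_tri p.[1] _ _) _.
apply: le_trans (lerD h1 (cabs_tri p.[(1 - d)%:C] _ _)) _.
rewrite (cabs_sym p.[(1 - d)%:C]).
have : 0 <= L * d by rewrite mulr_ge0 // ltW.
lra.
Qed.

Lemma radial_open (z : cpoint) (r : R) : in_closed_polydisc z -> 0 <= r -> r < 1 ->
  in_open_polydisc (fun i => r%:C * z i).
Proof.
move=> hz r0 r1 i; rewrite cabsM cabs_real ger0_norm //.
by apply: le_lt_trans r1; rewrite ler_piMr.
Qed.

Lemma Aplus_zero_closed f : in_Aplus f ->
  (forall z, in_open_polydisc z -> f z = 0) ->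
  forall z, in_closed_polydisc z -> f z = 0.
Proof.
move=> [a fa] f0 z hz; apply: cabs_le0_eq0; apply/ler_addgt0Pl => e e0.
have [r [r0 r1]] := Aplus_radial fa hz e0.
by rewrite (f0 _ (radial_open hz r0 r1)) subr0 addr0.
Qed.

Lemma Aplus_le_closed f (B : R) : in_Aplus f ->
  (forall z, in_open_polydisc z -> cabs (f z) <= B) ->
  forall z, in_closed_polydisc z -> cabs (f z) <= B.
Proof.
move=> [a fa] fB z hz; apply/ler_addgt0Pl => e e0.
have [r [r0 r1 hr]] := Aplus_radial fa hz e0.
have h1 := fB _ (radial_open hz r0 r1).
by have := cabs_rtri (f z) (f (fun i => r%:C * z i)); lra.
Qed.

(** Parseval over the grid of points whose coordinates are roots of unity; orthogonality of the
    characters factors over the coordinates. *)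
Lemma box_parseval (a : mindex -> C) N (B : R) :
  (forall z : cpoint, in_closed_polydisc z ->
     cabs (box_sum N (fun n => a n * monomial z n)) <= B) ->
  box_sum N (fun n => cabs (a n) ^+ 2) <= B ^+ 2.
Proof.
case: N => [|N] hB.
  have z1 : in_closed_polydisc ((fun=> 0) : cpoint) by move=> i; rewrite cabs0.
  have B0 : 0 <= B by apply: le_trans (hB _ z1); apply: cabs_ge0.
  (* A box of side 0 is empty if there is a coordinate; if there is none it has exactly one point,
     and the single term is the value of the sum. *)
  case: (pselect (exists i : 'I_k, True)) => [[i _]|ne].
    by rewrite box_sumE big1 ?sqr_ge0 // => m; case: (m i).
  pose m0 : {ffun 'I_k -> 'I_0} := [ffun i => match ne (ex_intro _ i I) with end].
  have uniq0 (m : {ffun 'I_k -> 'I_0}) : m = m0.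
    by apply/ffunP => i; have [] := ne (ex_intro _ i I).
  have := hB _ z1; rewrite !box_sumE (bigD1 m0) //= big1 => [|m]; last by rewrite (uniq0 m) eqxx.
  rewrite (bigD1 m0) //= big1 => [|m]; last by rewrite (uniq0 m) eqxx.
  rewrite !addr0 /monomial big1 ?mulr1 => [h|i _]; last by have [] := ne (ex_intro _ i I).
  by rewrite lerXn2r ?nnegrE ?cabs_ge0.
have [w pw] := @unit_root_exists R N.+1 isT.
pose T := {ffun 'I_k -> 'I_N.+1}.
pose chi (t m : T) := \prod_j w ^+ (t j * m j).
have orth m m' : \sum_t chi t m * cconj (chi t m') = (m == m')%:R * #|T|%:R.
  have -> : \sum_t chi t m * cconj (chi t m') =
     \sum_(t : T) \prod_j (w ^+ (t j * m j) * cconj (w ^+ (t j * m' j))).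
    by apply: eq_bigr => t _; rewrite /chi /cconj rmorph_prod -big_split.
  rewrite -(bigA_distr_bigA (fun (j : 'I_k) (s : 'I_N.+1) => w ^+ (s * m j) * cconj (w ^+ (s * m' j)))) /=.
  under eq_bigr => j _ do rewrite unit_root_orthogonal //.
  case: eqVneq => [->|ne].
    under eq_bigr => j _ do rewrite eqxx mul1r.
    by rewrite prodr_const mul1r card_ffun !card_ord natrX.
  rewrite mul0r; apply/eqP; rewrite prodf_seq_eq0; apply/hasP.
  have [j hj] : exists j, m j != m' j.
    apply: contrapT => h; case/eqP: ne; apply/ffunP => j; apply/eqP.
    by apply: contrapT => /negP e; apply: h; exists j.
  by exists j; rewrite ?mem_index_enum //= (negbTE hj) mul0r.
have cardT : 0 < #|T|%:R :> R by rewrite card_ffun !card_ord ltr0n expn_gt0.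
rewrite -(ler_pM2l cardT) box_sumE -(parseval_orthogonal (fun m : T => a (mval m)) orth).
apply: le_trans (_ : \sum_(t : T) B ^+ 2 <= _); last first.
  by rewrite sumr_const mulr_natl.
apply: ler_sum => t _; pose z : cpoint := fun j => w ^+ t j.
have hz : in_closed_polydisc z by move=> j; rewrite cabsX (cabs_prim_root pw) expr1n.
have h := hB z hz.
have B0 : 0 <= B by apply: le_trans h; apply: cabs_ge0.
rewrite lerXn2r ?nnegrE ?cabs_ge0 //; apply: le_trans h.
rewrite le_eqVlt; apply/orP; left; apply/eqP; congr cabs.
rewrite box_sumE; apply: eq_bigr => m _; congr (_ * _).
by rewrite /chi /monomial; apply: eq_bigr => j _; rewrite exprM.
Qed.

(** Partial sums over large boxes are bounded by 1 + d, and (1 + d)^2 <= 1 + 3 d because d <= 1. *)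
Lemma Aplus_parseval f a : Aplus_coeffs f a ->
  (forall z, in_open_polydisc z -> cabs (f z) <= 1) ->
  forall N, box_sum N (fun n => cabs (a n) ^+ 2) <= 1.
Proof.
move=> fa f1 N.
have {}f1 : forall z, in_closed_polydisc z -> cabs (f z) <= 1.
  by apply: Aplus_le_closed f1; exists a.
apply/ler_addgt0Pl => e e0.
have e3 : 0 < Num.min 1 (e / 3) by rewrite lt_min ltr01 divr_gt0.
have [K hK] := Aplus_uniform fa e3; set d := Num.min _ _ in e3 hK.
apply: (@le_trans _ _ (box_sum (maxn K N) (fun n => cabs (a n) ^+ 2))).
  by apply: box_sum_mono; rewrite ?leq_maxr // => n; rewrite sqr_ge0.
apply: (@le_trans _ _ ((1 + d) ^+ 2)).
  apply: box_parseval => z hz; have := hK _ (leq_maxl K N) z hz.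
  have := f1 z hz; rewrite cabs_sym.
  by have := cabs_rtri (box_sum (maxn K N) (fun n => a n * monomial z n)) (f z); lra.
have d1 : d <= 1 by rewrite ge_min lexx.
have d2 : d <= e / 3 by rewrite ge_min lexx orbT.
nra.
Qed.

(** The squared moduli sum to at most 1, and one coefficient already exhausts this. *)
Lemma Aplus_extremal_coeff f a n0 : Aplus_coeffs f a ->
  (forall z, in_open_polydisc z -> cabs (f z) <= 1) -> 1 <= cabs (a n0) ->
  cabs (a n0) = 1 /\ forall n, n <> n0 -> a n = 0.
Proof.
move=> fa f1 h0; have pars := Aplus_parseval fa f1.
have both n : n <> n0 -> cabs (a n) ^+ 2 + cabs (a n0) ^+ 2 <= 1.
  move=> ne; pose N := (\sum_i n i + \sum_i n0 i).+1.
  have [|m em] := @in_box_mval k N n.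
    by apply/in_boxP => i; rewrite ltnS (bigD1 i) //= -addnA leq_addr.
  have [|m0 em0] := @in_box_mval k N n0.
    by apply/in_boxP => i; rewrite ltnS addnC (bigD1 i) //= -addnA leq_addr.
  apply: le_trans (pars N); rewrite box_sumE (bigD1 m) //= em lerD2l.
  rewrite (bigD1 m0) /=; last by apply/eqP => e; apply: ne; rewrite -em -em0 e.
  by rewrite em0 lerDl sumr_ge0 // => i _; rewrite sqr_ge0.
have one : cabs (a n0) <= 1.
  pose N := (\sum_i n0 i).+1.
  have [|m0 em0] := @in_box_mval k N n0.
    by apply/in_boxP => i; rewrite ltnS (bigD1 i) //= leq_addr.
  have := pars N; rewrite box_sumE (bigD1 m0) //= em0.
  have : 0 <= \sum_(i | i != m0) cabs (a (mval i)) ^+ 2.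
    by apply: sumr_ge0 => i _; rewrite sqr_ge0.
  have := cabs_ge0 (a n0); nra.
have e1 : cabs (a n0) = 1 by apply/eqP; rewrite eq_le one.
split=> // n /both; rewrite e1 expr1n => h; apply: cabs_le0_eq0.
have := cabs_ge0 (a n); nra.
Qed.

Lemma Aplus_single_term f a n0 : Aplus_coeffs f a -> (forall n, n <> n0 -> a n = 0) ->
  forall z, in_closed_polydisc z -> f z = a n0 * monomial z n0.
Proof.
move=> [sa ha] h0 z hz; apply/eqP; rewrite -subr_eq0; apply/eqP/cabs_le0_eq0.
pose N := (\sum_i n0 i).+1.
apply: (converges_to_le (N1 := N)) (ha z hz) _ => N' NN'.
have [|m0 em0] := @in_box_mval k N' n0.
  by apply/in_boxP => i; apply: leq_trans NN'; rewrite ltnS (bigD1 i) //= leq_addr.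
rewrite box_sumE (bigD1 m0) //= em0 big1 ?addr0 ?subrr ?cabs0 // => m ne.
by rewrite h0 ?mul0r // => e; case/eqP: ne; apply: mval_inj; rewrite e.
Qed.

(** On the i-th coordinate axis every monomial involving another coordinate vanishes. *)
Lemma Aplus_axis_series f a (i : 'I_k) : Aplus_coeffs f a ->
  (forall N, \sum_(t < N) cabs (a (axis i t)) <= box_sum N (fun n => cabs (a n))) /\
  forall w, cabs w <= 1 ->
    converges_to (fun N => \sum_(t < N) a (axis i t) * w ^+ t)
                 (f (fun j => if j == i then w else 0)).
Proof.
move=> [sa ha]; split=> [N|w w1].
  pose H n := if [forall j, (j != i) ==> (n j == 0%N)] then cabs (a n) else 0.
  apply: (@le_trans _ _ (box_sum N H)); last first.
    by apply: box_sum_le => n; rewrite /H; case: ifP; rewrite ?cabs_ge0.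
  rewrite (box_sum_axis (i := i)) => [|n j ji nj]; last first.
    by rewrite /H; case: ifP => // /forallP/(_ j); rewrite ji => /eqP.
  apply: ler_sum => t _; rewrite /H; case: ifPn => // /forallP[] j.
  by case: eqVneq.
have hz : in_closed_polydisc (fun j => if j == i then w else 0).
  by move=> j; case: ifP; rewrite ?cabs0.
move=> e e0; have [N0 h0] := ha _ hz e e0; exists N0 => N /h0.
rewrite (box_sum_axis (i := i)) => [|n j ji nj]; last first.
  rewrite /monomial (bigD1 j) //= (negbTE ji) expr0n.
  by case: eqP => // _; rewrite mul0r mulr0.
by under [X in cabs (X - _) < _ -> _]eq_bigr => t _ do rewrite monomial_axis eqxx.
Qed.

End AplusFunctions.

(** * Automorphisms *)

Section DiscAutomorphism.
Variable R : realType.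
Local Notation C := R[i].

(** For |a| < 1, the disc automorphism taking [a] to 0; its inverse is [mobius (- a)]. *)
Definition mobius (a w : C) : C := (w - a) / (1 - cconj a * w).

Lemma cconjN (a : C) : cconj (- a) = - cconj a.
Proof. exact: rmorphN. Qed.

Lemma cconj1B (x : C) : cconj (1 - x) = 1 - cconj x.
Proof.
have -> : cconj (1 - x) = cconj 1 - cconj x by exact: rmorphB.
by congr (_ - _); apply: conjc1.
Qed.

Lemma cconjK (a : C) : cconj (cconj a) = a.
Proof. exact: conjcK. Qed.

Lemma mobius_den (a w : C) : cabs a < 1 -> cabs w <= 1 -> 1 - cconj a * w != 0.
Proof.
move=> a1 w1; rewrite -cabs_gt0; have := cabs_rtri 1 (cconj a * w).
rewrite cabs1 cabsM cabsJ.
have : cabs a * cabs w <= cabs a by rewrite ler_piMr ?cabs_ge0.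
lra.
Qed.

Lemma mobius_le1 (a w : C) : cabs a < 1 -> cabs w <= 1 -> cabs (mobius a w) <= 1.
Proof.
move=> a1 w1; have d0 := mobius_den a1 w1.
rewrite cabs_div ler_pdivrMr ?cabs_gt0 // mul1r.
rewrite -(ler_pXn2r (_ : 0 < 2)%N) ?nnegrE ?cabs_ge0 // -subr_ge0.
(* The classical identity that exhibits the gap between denominator and numerator as a product of
   nonnegative factors. *)
have -> : cabs (1 - cconj a * w) ^+ 2 - cabs (w - a) ^+ 2 =
          (1 - cabs a ^+ 2) * (1 - cabs w ^+ 2).
  have cD (x y : R) : (x - y)%:C = x%:C - y%:C by exact: rmorphB.
  have cM (x y : R) : (x * y)%:C = x%:C * y%:C by exact: rmorphM.
  apply: (@complexI R); rewrite cM !cD !sqr_cabs.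
  have -> : (1 : R)%:C = 1 by exact: rmorph1.
  rewrite cconj1B cconjM cconjK.
  have -> : cconj (w - a) = cconj w - cconj a by exact: rmorphB.
  ring.
have := cabs_ge0 a; have := cabs_ge0 w => w0 a0.
by rewrite mulr_ge0 ?subr_ge0 ?exprn_ile1 // ltW.
Qed.

Lemma mobius0r (a : C) : mobius a 0 = - a.
Proof. by rewrite /mobius mulr0 subr0 divr1 sub0r. Qed.

Lemma mobius0l (w : C) : mobius 0 w = w.
Proof. by rewrite /mobius /cconj conjc0 mul0r !subr0 divr1. Qed.

Lemma mobius_self (a : C) : mobius a a = 0.
Proof. by rewrite /mobius subrr mul0r. Qed.

Lemma mobiusK (a w : C) : cabs a < 1 -> cabs w <= 1 -> mobius (- a) (mobius a w) = w.
Proof.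
move=> a1 w1; have d0 := mobius_den a1 w1; have e0 := mobius_den a1 (ltW a1).
rewrite /mobius cconjN; field; rewrite d0 /=.
apply: contra e0 => /eqP h; apply/eqP; rewrite -h; ring.
Qed.

Lemma disc_algebra_mobius (a x : C) : cabs a < 1 -> cabs x <= 1 ->
  disc_algebra (fun z => mobius a (x * z)).
Proof.
move=> a1 x1.
have -> : (fun z => mobius a (x * z)) =
          (fun z => (x%:P * 'X - a%:P).[z] * (1 - (cconj a * x) * z)^-1).
  by apply: funext => z; rewrite /mobius !hornerE.
apply: disc_algebraM; first exact: disc_algebra_poly.
apply: disc_algebra_geom; rewrite cabsM cabsJ.
by apply: le_lt_trans a1; rewrite ler_piMr ?cabs_ge0.
Qed.

Lemma in_Aplus_mobius k (i : 'I_k) (a : C) : cabs a < 1 ->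
  in_Aplus (fun z : @cpoint R k => mobius a (z i)).
Proof.
move=> a1; apply: in_AplusM; last by apply: Aplus_geom; rewrite cabsJ.
by apply: in_AplusD; [apply: Aplus_coord | apply: in_Aplus_const i _].
Qed.

End DiscAutomorphism.

(** * First-order expansion at the origin and the norm of A+ *)

Section OriginExpansion.
Variables (R : realType) (k : nat).
Local Notation C := R[i].
Local Notation mindex := (mindex k).
Local Notation cpoint := (@cpoint R k).
Implicit Types (f g : cpoint -> C) (a b : mindex -> C).

Lemma axis0 (i : 'I_k) : axis i 0 = (fun=> 0%N).
Proof. by apply: funext => j; rewrite /axis; case: ifP. Qed.

Lemma big_ord_recl2 (V : nmodType) N (F : nat -> V) :
  \sum_(t < N.+2) F t = F 0%N + (F 1%N + \sum_(t < N) F t.+2).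
Proof. by rewrite -(big_mkord xpredT F) 2?big_nat_recl // big_mkord. Qed.

Lemma axis_le f a (i : 'I_k) (B : R) (w : C) : Aplus_coeffs f a ->
  (forall N, box_sum N (fun n => cabs (a n)) <= B) -> cabs w <= 1 ->
  cabs (f (fun j => if j == i then w else 0) - (a (fun=> 0%N) + a (axis i 1) * w))
    <= B * cabs w ^+ 2.
Proof.
move=> fa aB w1; have [h1 h2] := Aplus_axis_series i fa.
apply: (converges_to_le (N1 := 2)) (h2 w w1) _ => -[|[|N]] // _.
rewrite (big_ord_recl2 _ (fun t => a (axis i t) * w ^+ t)) axis0 expr0 mulr1 expr1.
set S := \sum_(t < N) _; set x := a _; set y := _ * w.
have -> : x + (y + S) - (x + y) = S by ring.
apply: le_trans (cabs_sum _ _ _) _.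
apply: (@le_trans _ _ (\sum_(t < N) cabs (a (axis i t.+2)) * cabs w ^+ 2)).
  apply: ler_sum => t _; rewrite cabsM cabsX ler_wpM2l ?cabs_ge0 //.
  by rewrite ler_wiXn2l ?cabs_ge0.
rewrite -mulr_suml ler_wpM2r ?exprn_ge0 ?cabs_ge0 //.
apply: le_trans (aB N.+2); apply: le_trans (h1 N.+2).
rewrite (big_ord_recl2 _ (fun t => cabs (a (axis i t)))).
by have := cabs_ge0 (a (axis i 0)); have := cabs_ge0 (a (axis i 1)); lra.
Qed.

Lemma Aplus_at0 f a (i : 'I_k) : Aplus_coeffs f a -> f (fun=> 0) = a (fun=> 0%N).
Proof.
move=> fa; have [B hB] := fa.1.
have w1 : cabs (0 : C) <= 1 by rewrite cabs0.
have := axis_le i fa hB w1; rewrite mulr0 addr0 cabs0 expr0n /= mulr0.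
move=> /cabs_le0_eq0/eqP; rewrite subr_eq0 => /eqP <-; congr f.
by apply: funext => j; case: ifP.
Qed.

Lemma Aplus_norm_ge a N : abs_summable a ->
  box_sum N (fun n => cabs (a n)) <= Aplus_norm a.
Proof.
case=> B hB; apply: ub_le_sup; first by exists B => _ [m _ <-].
by exists N.
Qed.

Lemma Aplus_norm_le a (B : R) : (forall N, box_sum N (fun n => cabs (a n)) <= B) ->
  Aplus_norm a <= B.
Proof.
by move=> hB; apply: ge_sup => [|_ [N _ <-]]; [exists (box_sum 0 (fun n => cabs (a n))), 0%N|].
Qed.

Lemma uniform_small (d : 'I_k -> R) : (forall j, 0 < d j) ->
  exists t, [/\ 0 < t, t < 1 & forall j, t < d j].
Proof.
move=> d0; pose S := \sum_j (d j)^-1.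
have S0 : 0 <= S by apply: sumr_ge0 => j _; rewrite invr_ge0 ltW.
have P0 : 0 < 2 + S by lra.
exists (2 + S)^-1; split=> [||j]; first by rewrite invr_gt0.
  by rewrite invf_lt1 //; lra.
rewrite invf_plt ?posrE //; apply: le_lt_trans (_ : S < _); last by lra.
rewrite /S (bigD1 j) //= lerDl sumr_ge0 // => l _; rewrite invr_ge0; exact: ltW.
Qed.

End OriginExpansion.

(** * Rigidity of the symbol of an automorphism *)

Section AutomorphismRigid.
Variables (R : realType) (k : nat).
Local Notation C := R[i].
Local Notation mindex := (mindex k).
Local Notation cpoint := (@cpoint R k).
Variable phi : cpoint -> cpoint.
Hypothesis phi_maps : forall z, in_open_polydisc z -> in_closed_polydisc (phi z).
Hypothesis phi_bounded : Cphi_bounded phi.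
Hypothesis phi_inj : forall f1 f2 g, Cphi_graph phi f1 g -> Cphi_graph phi f2 g ->
     forall z, in_closed_polydisc z -> f1 z = f2 z.
Hypothesis phi_surj : forall g, in_Aplus g -> exists f, Cphi_graph phi f g.

Let origin : cpoint := fun=> 0.

Let origin_open : in_open_polydisc origin.
Proof. by move=> i; rewrite /origin cabs0. Qed.

Lemma pullback f : in_Aplus f -> exists g b, Aplus_coeffs g b /\ Cphi_graph phi f g.
Proof.
move=> [a fa]; have [M [_ hM]] := phi_bounded.
have [g [b [gb [gphi _]]]] := hM f a fa.
by exists g, b; split=> //; split; [exists a | split; [exists b|]].
Qed.

(** If lam = psi(w) had modulus above 1, 1 / (lam - z_i) would be a geometric series in A+, the
    image of some H. Then (lam - psi) H and 1 have the same image, so they agree on the closed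
    polydisc, which fails at [w]. *)
Lemma inverse_coord_le1 i psi : Cphi_graph phi psi (fun z => z i) ->
  forall w, in_closed_polydisc w -> cabs (psi w) <= 1.
Proof.
move=> [psiA [_ hpsi]] w hw; rewrite leNgt; apply/negP => lt1.
set lam := psi w in lt1; have lam0 : lam != 0 by rewrite -cabs_gt0; lra.
have lamV : cabs lam^-1 < 1 by rewrite cabsV invf_lt1 //; lra.
have gA : in_Aplus (fun z : cpoint => lam^-1 * (1 - lam^-1 * z i)^-1).
  by apply: in_AplusM; [apply: in_Aplus_const i _ | apply: Aplus_geom].
have [H [HA [_ hH]]] := phi_surj gA.
have oneA : in_Aplus (fun _ : cpoint => 1 : C) by apply: in_Aplus_const i _.
have fA : in_Aplus (fun z => (lam + (-1) * psi z) * H z).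
  apply: in_AplusM => //; apply: in_AplusD; first exact: in_Aplus_const i _.
  by apply: in_AplusM => //; apply: in_Aplus_const i _.
have G1 : Cphi_graph phi (fun z => (lam + (-1) * psi z) * H z) (fun=> 1).
  split=> //; split=> // z hz; rewrite -hpsi // -hH //.
  have nz : 1 - lam^-1 * z i != 0.
    have := cabs_rtri 1 (lam^-1 * z i); rewrite cabs1 cabsM -cabs_gt0.
    have : cabs lam^-1 * cabs (z i) <= cabs lam^-1.
      by rewrite ler_piMr ?cabs_ge0 // ltW.
    lra.
  have -> : lam + -1 * z i = lam * (1 - lam^-1 * z i).
    by rewrite mulrBr mulr1 mulVKf // mulN1r.
  by rewrite mulrACA divff // mul1r divff.
have G2 : Cphi_graph phi (fun=> 1) (fun=> 1) by [].
have := phi_inj G1 G2 hw; rewrite -/lam mulN1r subrr mul0r => /eqP.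
by rewrite eq_sym oner_eq0.
Qed.

Let a (j : 'I_k) : C := phi origin j.

(** Otherwise the constant coefficient of phi_j has modulus at least 1 and phi_j is a constant of
    modulus 1. The j-th coordinate and that constant then have the same image, against injectivity
    at the origin. *)
Lemma phi_origin_lt1 j : cabs (a j) < 1.
Proof.
have [g [b [gb G]]] := pullback (Aplus_coord R j).
have [_ [gA hg]] := G.
have g1 z : in_open_polydisc z -> cabs (g z) <= 1.
  by move=> hz; rewrite hg //; apply: phi_maps.
have b0 : b (fun=> 0%N) = a j by rewrite -(Aplus_at0 j gb) hg.
rewrite ltNge; apply/negP; rewrite -b0 => h.
have [e1 hb] := Aplus_extremal_coeff gb g1 h.
have gc z : in_closed_polydisc z -> g z = b (fun=> 0%N).
  move=> hz; rewrite (Aplus_single_term gb hb hz) /monomial big1 ?mulr1 // => l _.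
have constG : Cphi_graph phi (fun=> b (fun=> 0%N)) g.
  split; first exact: in_Aplus_const j _.
  by split=> // z hz; apply: gc; apply: open_closed_polydisc.
have := phi_inj G constG (open_closed_polydisc origin_open).
by rewrite /origin => e; have := e1; rewrite -e cabs0 => /eqP; rewrite eq_sym oner_eq0.
Qed.

Lemma coord_le_mobius i z : in_open_polydisc z ->
  exists j, cabs (z i) <= cabs (mobius (a j) (phi z j)).
Proof.
move=> hz; have [psi G] := phi_surj (Aplus_coord R i).
have psi1 := inverse_coord_le1 G; have [[c psic] [_ hpsi]] := G.
pose m j := cabs (mobius (a j) (phi z j)).
case: (@Order.TotalTheory.arg_maxP _ R 'I_k i predT m isT) => j0 _ jmax.
exists j0; rewrite -/(m j0); set r := m j0.
have r0 : 0 <= r by apply: cabs_ge0.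
have r1 : r <= 1 by apply: mobius_le1; [apply: phi_origin_lt1 | apply: phi_maps].
have phiE j : mobius (- a j) (mobius (a j) (phi z j)) = phi z j.
  by apply: mobiusK; [apply: phi_origin_lt1 | apply: phi_maps].
(* If r = 0 then phi(z) = phi(0), and applying [psi] gives z_i = 0; otherwise one may divide by
   r. *)
have [rz|rp] := eqVneq r 0.
  have -> : z i = 0; last by rewrite cabs0.
  rewrite hpsi // -[RHS]/(origin i) (hpsi origin origin_open); congr psi.
  apply: funext => j; rewrite -phiE.
  have -> : mobius (a j) (phi z j) = 0.
    by apply: cabs_le0_eq0; rewrite -rz; apply: jmax.
  by rewrite mobius0r opprK.
have rp' : 0 < r by rewrite lt_neqAle eq_sym rp.
pose zeta j := mobius (a j) (phi z j) / r%:C.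
have zeta1 j : cabs (zeta j) <= 1.
  rewrite /zeta cabs_div cabs_real gtr0_norm // ler_pdivrMr // mul1r; exact: jmax.
(* The analytic disc inside passes through phi(0) at w = 0 and through phi(z) at w = r, so h(0) = 0
   and h(r) = z_i. *)
pose h w := psi (fun j => mobius (- a j) (zeta j * w)).
have hdisc : disc_algebra h.
  apply: (Aplus_disc_algebra psic (x := fun j w => mobius (- a j) (zeta j * w))).
    by move=> j; apply: disc_algebra_mobius => //; rewrite cabsN phi_origin_lt1.
  move=> j w w1; apply: mobius_le1; first by rewrite cabsN phi_origin_lt1.
  by rewrite cabsM mulr_ile1 ?cabs_ge0.
have h0 : h 0 = 0.
  rewrite -[RHS]/(origin i) (hpsi origin origin_open) /h; congr psi.
  by apply: funext => j; rewrite mulr0 mobius0r opprK.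
have h1 w : cabs w <= 1 -> cabs (h w) <= 1.
  move=> w1; apply: psi1 => j; apply: mobius_le1; first by rewrite cabsN phi_origin_lt1.
  by rewrite cabsM mulr_ile1 ?cabs_ge0.
have cr : cabs (r%:C : C) = r by rewrite cabs_real ger0_norm.
have := disc_algebra_schwarz hdisc h0 h1 (_ : cabs r%:C <= 1); rewrite cr => /(_ r1).
rewrite (_ : h r%:C = z i) // /h hpsi //; congr psi; apply: funext => j.
rewrite /zeta divfK ?phiE //.
by rewrite -cabs_gt0 cr.
Qed.

Lemma mobius_phi_coord : exists (s : {perm 'I_k}) (eps : 'I_k -> C),
  (forall j, cabs (eps j) = 1) /\
  forall z, in_open_polydisc z -> forall j, mobius (a j) (phi z j) = eps j * z (s j).
Proof.
have hF j : exists Fb : (cpoint -> C) * (mindex -> C), Aplus_coeffs Fb.1 Fb.2 /\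
    forall z, in_open_polydisc z -> Fb.1 z = mobius (a j) (phi z j).
  have [g [b [gb [_ [_ hg]]]]] := pullback (in_Aplus_mobius j (phi_origin_lt1 j)).
  by exists (g, b).
have [Fb hFb] := boolp.choice hF.
pose F j := (Fb j).1; pose b j := (Fb j).2.
have Fcoef j : Aplus_coeffs (F j) (b j) by apply: (hFb j).1.
have FE j z : in_open_polydisc z -> F j z = mobius (a j) (phi z j) by apply: (hFb j).2.
have F1 j z : in_open_polydisc z -> cabs (F j z) <= 1.
  by move=> hz; rewrite FE //; apply: mobius_le1; [apply: phi_origin_lt1 | apply: phi_maps].
have b0 j : b j (fun=> 0%N) = 0 by rewrite -(Aplus_at0 j (Fcoef j)) FE // mobius_self.
have ex_large i : exists j, 1 <= cabs (b j (axis i 1)).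
  apply: contrapT => none.
  have lt1 j : cabs (b j (axis i 1)) < 1.
    by rewrite ltNge; apply/negP => h; apply: none; exists j.
  have hB j : exists B, forall N, box_sum N (fun n => cabs (b j n)) <= B.
    by have [B ?] := (Fcoef j).1; exists B.
  have [B {}hB] := boolp.choice hB.
  have B0 j : 0 <= B j.
    by apply: le_trans (hB j 0%N); apply: box_sum_ge0 => n; apply: cabs_ge0.
  (* For 0 < t < d_j the first-order term plus the remainder B_j t^2 is smaller than t, so no F_j
     reaches modulus t at t e_i, against [coord_le_mobius]. *)
  pose d j := (1 - cabs (b j (axis i 1))) / (B j + 1).
  have d0 j : 0 < d j by rewrite divr_gt0 ?subr_gt0 //; have := B0 j; lra.
  have [t [t0 t1 td]] := uniform_small d0.
  pose z : cpoint := fun j => if j == i then t%:C else 0.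
  have ct : cabs (t%:C : C) = t by rewrite cabs_real gtr0_norm.
  have hz : in_open_polydisc z by move=> j; rewrite /z; case: ifP; rewrite ?ct ?cabs0.
  have [j] := coord_le_mobius i hz; rewrite -FE // /z eqxx ct => h1.
  have ct1 : cabs (t%:C : C) <= 1 by rewrite ct ltW.
  have := axis_le i (Fcoef j) (hB j) ct1; rewrite b0 add0r ct => h2.
  have := cabs_rtri (F j (fun l => if l == i then t%:C else 0)) (b j (axis i 1) * t%:C).
  rewrite cabsM ct => h3.
  have := td j; rewrite ltr_pdivlMr; last by have := B0 j; lra.
  have := B0 j; have := cabs_ge0 (b j (axis i 1)); nra.
have [s hs] := boolp.choice ex_large.
have term i := Aplus_extremal_coeff (Fcoef (s i)) (F1 (s i)) (hs i).
have axis_inj (i1 i2 : 'I_k) : axis i1 1 = axis i2 1 -> i1 = i2.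
  move=> e; have := congr1 (fun n : mindex => n i1) e; rewrite /axis eqxx.
  by case: eqP.
(* [F (s i)] is a unimodular multiple of z_i alone, so it determines [i]. *)
have s_inj : injective s.
  move=> i1 i2 e; apply: axis_inj; apply: contrapT => ne.
  have := (term i2).2 _ ne; rewrite -e => z0.
  by have := (term i1).1; rewrite z0 cabs0 => /eqP; rewrite eq_sym oner_eq0.
pose p := perm s_inj.
(* [p] sends a coordinate of z to the component of phi that depends on it; the statement asks for
   the opposite direction. *)
exists (p^-1)%g, (fun j => b j (axis (p^-1%g j) 1)).
have sK j : s (p^-1%g j) = j by rewrite -[s _]permE permKV.
split=> [j|z hz j].
  by have := (term (p^-1%g j)).1; rewrite sK.
rewrite -FE //; have := (term (p^-1%g j)).2; rewrite sK => h.
by rewrite (Aplus_single_term (Fcoef j) h (open_closed_polydisc hz)) monomial_axis expr1.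
Qed.

(** On the axis of coordinate s(j), unimodular changes of variable and value turn phi_j into v(z) =
    (z + rho) / (1 + rho z), rho = |a_j|. The images of the powers of the j-th coordinate then have
    norm at most [M], which bounds the coefficient norms of all v^n. *)
Lemma phi_fixes_origin (s : 'I_k -> 'I_k) (eps : 'I_k -> C) : (forall j, cabs (eps j) = 1) ->
  (forall z, in_open_polydisc z -> forall j, mobius (a j) (phi z j) = eps j * z (s j)) ->
  forall j, a j = 0.
Proof.
move=> eps1 hphi j; apply/eqP; apply: contrapT => /negP aj0.
pose rho := cabs (a j); have rho0 : 0 < rho by rewrite cabs_gt0.
have rho1 : rho < 1 by apply: phi_origin_lt1.
have [M [M0 hM]] := phi_bounded.
apply: (@mobius_powers_unbounded R rho rho0 rho1 M) => n.
have [u [hu u1]] := Aplus_pow R j n.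
have [g [c [gc [hg cM]]]] := hM _ _ hu.
have rhoC : rho%:C != 0 :> C by rewrite -cabs_gt0 cabs_real gtr0_norm.
pose tau := a j / rho%:C.
have tau1 : cabs tau = 1 by rewrite cabs_div cabs_real gtr0_norm // divff // gt_eqF.
have tau0 := unimodular_neq0 tau1; have eps0 := unimodular_neq0 (eps1 j).
have aE : a j = tau * rho%:C by rewrite /tau divfK.
have aJ : cconj (a j) * tau = rho%:C.
  by rewrite /tau mulrA [_ * a j]mulrC -sqr_cabs -/rho rmorphXn /= expr2 mulfK.
(* [tau] is the phase of a_j, and [kap] makes eps_j kap z equal to tau z, so that tau factors out of
   the Moebius map. *)
pose kap := tau / eps j.
have kap1 : cabs kap = 1 by rewrite cabs_div tau1 eps1 divr1.
pose i := s j.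
have [h1 h2] := Aplus_axis_series i gc.
exists (fun m => tau ^- n * (c (axis i m) * kap ^+ m)); split=> [N|z z1].
  apply: le_trans (_ : Aplus_norm c <= _); last first.
    apply: le_trans cM _; rewrite ler_piMr //; exact: Aplus_norm_le.
  apply: le_trans (Aplus_norm_ge N gc.1); apply: le_trans (h1 N).
  apply: ler_sum => m _; rewrite !cabsM cabsV !cabsX tau1 kap1 !expr1n invr1.
  by rewrite mul1r mulr1.
have kz : cabs (kap * z) < 1 by rewrite cabsM kap1 mul1r.
pose pt : cpoint := fun l => if l == i then kap * z else 0.
move=> e e0; have [N0 hN0] := h2 _ (ltW kz) e e0; exists N0 => N /hN0; rewrite -/pt.
have hpt : in_open_polydisc pt.
  by move=> l; rewrite /pt; case: ifP; rewrite ?cabs0.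
have phij : phi pt j = tau * ((z + rho%:C) / (1 + rho%:C * z)).
  have := hphi pt hpt j; rewrite /pt -/i eqxx => hm.
  rewrite -[LHS](mobiusK (phi_origin_lt1 j) (phi_maps hpt j)) hm.
  have -> : eps j * (kap * z) = tau * z by rewrite mulrA [eps j * _]mulrC divfK.
  rewrite /mobius cconjN mulNr !opprK [cconj _ * _]mulrA aJ aE -mulrDr.
  by rewrite -mulrA.
rewrite hg // phij => lt_e; apply: le_lt_trans lt_e.
rewrite le_eqVlt; apply/orP; left; apply/eqP.
set S1 := \sum_(m < N) _; set S2 := \sum_(m < N) _; set v := (_ / _).
have -> : S1 = tau ^- n * S2.
  by rewrite /S1 /S2 mulr_sumr; apply: eq_bigr => m _; rewrite [(kap * z) ^+ m]exprMn !mulrA.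
have -> : tau ^- n * S2 - v ^+ n = tau ^- n * (S2 - (tau * v) ^+ n).
  by rewrite mulrBr [(tau * v) ^+ n]exprMn mulKf // expf_neq0.
by rewrite cabsM cabsV cabsX tau1 expr1n invr1 mul1r.
Qed.

End AutomorphismRigid.

(** * The converse: permutations and rotations of the coordinates *)

Section MonomialMaps.
Variables (R : realType) (k : nat).
Local Notation C := R[i].
Local Notation mindex := (mindex k).
Local Notation cpoint := (@cpoint R k).

Lemma box_sum_perm (V : nmodType) (p : {perm 'I_k}) N (F : mindex -> V) :
  box_sum N (fun n => F (fun i => n (p i))) = box_sum N F.
Proof.
pose h (q : {perm 'I_k}) (m : {ffun 'I_k -> 'I_N}) : {ffun 'I_k -> 'I_N} :=
  [ffun i => m (q i)].
have hK : cancel (h p) (h p^-1%g).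
  by move=> m; apply/ffunP => i; rewrite !ffunE permKV.
rewrite !box_sumE [RHS](reindex_inj (can_inj hK)); apply: eq_bigr => m _.
by congr F; apply: funext => i; rewrite /mval ffunE.
Qed.

(** The substitution permutes the exponents and multiplies the coefficients by unimodular numbers,
    so absolute summability is kept. *)
Lemma in_Aplus_perm (p : {perm 'I_k}) (dlt : 'I_k -> C) (g : cpoint -> C) :
  (forall j, cabs (dlt j) = 1) -> in_Aplus g ->
  in_Aplus (fun w => g (fun j => dlt j * w (p j))).
Proof.
move=> d1 [b [[M hM] hg]].
pose G n := b n * \prod_j dlt j ^+ n j.
exists (fun n => G (fun i => n (p i))); split.
  exists M => N; rewrite (box_sum_perm p N (fun n => cabs (G n))).
  apply: le_trans (hM N); apply: box_sum_le => n.
  rewrite cabsM cabs_prod big1 ?mulr1 // => j _.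
  by rewrite cabsX d1 expr1n.
move=> w hw e e0.
have hz : in_closed_polydisc (fun j => dlt j * w (p j)) by move=> j; rewrite cabsM d1 mul1r.
have [N0 h0] := hg _ hz e e0; exists N0 => N /h0.
rewrite -(box_sum_perm p N (fun n => b n * monomial (fun j => dlt j * w (p j)) n)).
congr (cabs (_ - _) < e); apply: eq_box_sum => n.
rewrite /G -mulrA; congr (_ * _); rewrite /monomial.
rewrite [X in _ = _ * X](reindex_inj (@perm_inj _ p)) -big_split /=.
by apply: eq_bigr => j _; rewrite exprMn.
Qed.

Lemma rotation_automorphism (phi : cpoint -> cpoint) (s : {perm 'I_k}) (eps : 'I_k -> C) :
  (0 < k)%N -> (forall i, cabs (eps i) = 1) ->
  (forall z, in_open_polydisc z -> forall i, phi z i = eps i * z (s i)) ->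
  Cphi_automorphism phi.
Proof.
move=> k0 eps1 hphi; pose i0 : 'I_k := Ordinal k0.
pose inv (w : cpoint) : cpoint := fun j => (eps (s^-1%g j))^-1 * w (s^-1%g j).
have eps0 i : eps i != 0 by apply: unimodular_neq0.
split=> [f1 f2 g [f1A [_ h1]] [f2A [_ h2]] z hz|g gA].
  (* [phi] maps the open polydisc onto itself, with [inv] as right inverse; equality on the closed
     polydisc then follows by radial approach. *)
  have eq_open w : in_open_polydisc w -> f1 w = f2 w.
    move=> hw; have hi : in_open_polydisc (inv w).
      by move=> j; rewrite /inv cabsM cabsV eps1 invr1 mul1r.
    have <- : phi (inv w) = w.
      by apply: funext => i; rewrite hphi // /inv permK mulVKf.
    by rewrite -h1 // h2.
  have dA : in_Aplus (fun w => f1 w + (-1) * f2 w).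
    by apply: in_AplusD => //; apply: in_AplusM => //; apply: in_Aplus_const i0 _.
  have := Aplus_zero_closed dA _ hz; rewrite mulN1r => h.
  apply/eqP; rewrite -subr_eq0; apply/eqP/h => w hw.
  by rewrite eq_open // mulN1r subrr.
exists (fun w => g (inv w)); split.
  by apply: in_Aplus_perm => // j; rewrite cabsV eps1 invr1.
split=> // z hz; congr g; apply: funext => j.
by rewrite /inv hphi // permKV mulKf.
Qed.

End MonomialMaps.

Theorem theorem11 (R : realType) (k : nat) (hk : (1 <= k)%N)
  (phi : @cpoint R k -> @cpoint R k)
  (phi_analytic : forall j : 'I_k, analytic_on_polydisc (fun z => phi z j))
  (phi_maps : forall z, in_open_polydisc z -> in_closed_polydisc (phi z))
  (phi_bounded : Cphi_bounded phi) :
  Cphi_automorphism phi <->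
  exists (s : {perm 'I_k}) (eps : 'I_k -> R[i]),
    (forall i, cabs (eps i) = 1) /\
    forall z, in_open_polydisc z -> forall i, phi z i = eps i * z (s i).
Proof.
split=> [[inj surj]|[s [eps [eps1 hphi]]]]; last exact: rotation_automorphism hphi.
have [s [eps [eps1 hphi]]] := mobius_phi_coord phi_maps phi_bounded inj surj.
exists s, eps; split=> // z hz i; rewrite -hphi //.
by rewrite (phi_fixes_origin phi_maps phi_bounded inj eps1 hphi) mobius0l.
Qed.
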